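(* Let $\Gamma$ be a connected finite simplicial graph and let $\mathcal{H}$ be a finite collection of finitely generated subgroups of the right-angled Coxeter group $G_\Gamma$. If $\mathcal{H}$ is malnormal, then $\mathcal{H}$ is hyperbolically embedded in $G_\Gamma$. In addition, the converse is also true if all subgroups in $\mathcal{H}$ are torsion free: if all subgroups in $\mathcal{H}$ are torsion free and $\mathcal{H}$ is hyperbolically embedded in $G_\Gamma$, then $\mathcal{H}$ is malnormal.
   Context: Right-angled Coxeter group: for a finite simplicial graph $\Gamma$ with vertex set $S$, $G_\Gamma$ is the group generated by $S$ with relations $s^2=1$ for all $s\in S$ and $st=ts$ whenever $s,t$ are adjacent vertices. Malnormal collection: a collection $\mathcal{H}$ of subgroups of $G$ is malnormal if for all $H,H'\in\mathcal{H}$ and $g\in G$, $H\cap gH'g^{-1}\ne\{e\}$ implies $H=H'$ and $g\in H$. Hyperbolically embedded (Dahmani–Guirardel–Osin): a collection $\{H_\lambda\}$ of subgroups of $G$ is hyperbolically embedded in $G$ if there is a subset $X\subset G$ such that $X\cup\bigcup_\lambda H_\lambda$ generates $G$ and: (i) the Cayley graph $\mathrm{Cay}(G,X\sqcup\bigsqcup_\lambda H_\lambda)$ (letters from different pieces of the disjoint union being regarded as distinct) is Gromov hyperbolic; (ii) for every $\lambda$, the metric $\hat d_\lambda\colon H_\lambda\times H_\lambda\to[0,\infty]$ is locally finite (all balls of finite radius are finite), where $\hat d_\lambda(h,k)$ is the length of a shortest path from $h$ to $k$ in this Cayley graph that uses no edge of the complete subgraph $\mathrm{Cay}(H_\lambda,H_\lambda)$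 (the edges joining elements of $H_\lambda$ and labelled by letters of $H_\lambda$), and $\hat d_\lambda(h,k)=\infty$ if there is no such path. *)

(* Defs.v *)
From HB Require Import structures.
From mathcomp Require Import all_boot.
From mathcomp Require Import generic_quotient.
From mathcomp Require Import all_classical.

Set Implicit Arguments.
Unset Strict Implicit.
Unset Printing Implicit Defensive.

Local Open Scope quotient_scope.
Local Open Scope classical_set_scope.
Local Open Scope group_scope.

(* ** Groups given by generators and relations *)

(* The letter (s, false) is the generator s, (s, true) its formal inverse. *)
Notation word S := (seq (S * bool)).

Definition winv (S : Type) (w : word S) : word S :=
  rev [seq (a.1, ~~ a.2) | a <- w].

(* [R u v] reads "u = v is a defining relation". *)
Inductive pres_eq (S : Type) (R : word S -> word S -> Prop) :
    word S -> word S -> Prop :=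
| pres_refl u : pres_eq R u u
| pres_sym u v : pres_eq R u v -> pres_eq R v u
| pres_trans u v w : pres_eq R u v -> pres_eq R v w -> pres_eq R u w
| pres_cat u u' v v' :
    pres_eq R u u' -> pres_eq R v v' -> pres_eq R (u ++ v) (u' ++ v')
| pres_cancel s b : pres_eq R [:: (s, b); (s, ~~ b)] [::]
| pres_rel u v : R u v -> pres_eq R u v.

Section PresentedGroup.
Variables (S : choiceType) (R : word S -> word S -> Prop).

Definition pres_eqb : rel (word S) := fun u v => `[< pres_eq R u v >].

Lemma pres_eqb_refl : reflexive pres_eqb.
Proof. by move=> u; apply/asboolP; exact: pres_refl. Qed.

Lemma pres_eqb_sym : symmetric pres_eqb.
Proof. by move=> u v; apply/asboolP/asboolP; exact: pres_sym. Qed.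

Lemma pres_eqb_trans : transitive pres_eqb.
Proof.
move=> v u w /asboolP uv /asboolP vw; apply/asboolP; exact: pres_trans uv vw.
Qed.

Canonical pres_equiv := EquivRel pres_eqb
  pres_eqb_refl pres_eqb_sym pres_eqb_trans.

Definition presented_group : Type := {eq_quot pres_equiv}.

HB.instance Definition _ := Choice.on presented_group.

Definition pg_class (u : word S) : presented_group :=
  (\pi_{eq_quot pres_equiv} u)%qT.

Definition pg_repr (x : presented_group) : word S :=
  repr (x : {eq_quot pres_equiv}).

Lemma pg_reprK : cancel pg_repr pg_class.
Proof. by move=> x; exact: reprK. Qed.

Lemma pg_classP u v : pg_class u = pg_class v <-> pres_eq R u v.
Proof. by split=> [/eqmodP/asboolP|uv]; last exact/eqmodP/asboolP. Qed.

Lemma pg_repr_class u : pres_eq R (pg_repr (pg_class u)) u.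
Proof. by apply/pg_classP; rewrite pg_reprK. Qed.

Definition pg_one : presented_group := pg_class [::].
Definition pg_mul (x y : presented_group) : presented_group :=
  pg_class (pg_repr x ++ pg_repr y).
Definition pg_inv (x : presented_group) : presented_group :=
  pg_class (winv (pg_repr x)).

Lemma pg_mulE u v : pg_mul (pg_class u) (pg_class v) = pg_class (u ++ v).
Proof. by apply/pg_classP; apply: pres_cat; exact: pg_repr_class. Qed.

Lemma winv_cons (a : S * bool) (w : word S) :
  winv (a :: w) = winv w ++ [:: (a.1, ~~ a.2)].
Proof. by rewrite /winv /= rev_cons cats1. Qed.

Lemma winvK : involutive (@winv S).
Proof.
move=> w; rewrite /winv -map_rev revK -map_comp map_id_in // => -[s b] _ /=.
by rewrite negbK.
Qed.

Lemma pres_mulwV (w : word S) : pres_eq R (w ++ winv w) [::].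
Proof.
elim: w => [|[s b] w IH]; first exact: pres_refl.
rewrite winv_cons /= -cat1s catA -(cat1s (s, b)).
apply: pres_trans (pres_cancel R s b).
rewrite -[[:: (s, b); _]]/([:: (s, b)] ++ [:: (s, ~~ b)]) -catA.
apply: pres_cat; first exact: pres_refl.
rewrite -[X in pres_eq _ _ X]cat0s catA.
by apply: pres_cat => //; exact: pres_refl.
Qed.

Lemma pres_mulVw (w : word S) : pres_eq R (winv w ++ w) [::].
Proof. by rewrite -{2}(winvK w); exact: pres_mulwV. Qed.

Lemma pg_mulA : associative pg_mul.
Proof.
move=> x y z; rewrite -(pg_reprK x) -(pg_reprK y) -(pg_reprK z).
by rewrite !pg_mulE catA.
Qed.

Lemma pg_mul1g : left_id pg_one pg_mul.
Proof. by move=> x; rewrite -(pg_reprK x) pg_mulE. Qed.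

Lemma pg_mulg1 : right_id pg_one pg_mul.
Proof. by move=> x; rewrite -(pg_reprK x) pg_mulE cats0. Qed.

Lemma pg_mulVg : left_inverse pg_one pg_inv pg_mul.
Proof.
move=> x; rewrite -{2}(pg_reprK x) pg_mulE; apply/pg_classP.
exact: pres_mulVw.
Qed.

Lemma pg_mulgV : right_inverse pg_one pg_inv pg_mul.
Proof.
move=> x; rewrite -{1}(pg_reprK x) pg_mulE; apply/pg_classP.
exact: pres_mulwV.
Qed.

HB.instance Definition _ := isGroup.Build presented_group
  pg_mulA pg_mul1g pg_mulg1 pg_mulVg pg_mulgV.

End PresentedGroup.

(* ** Right-angled Coxeter groups *)

Inductive racg_rel (V : Type) (e : rel V) : word V -> word V -> Prop :=
| racg_sq s : racg_rel e [:: (s, false); (s, false)] [::]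
| racg_comm s t : e s t ->
    racg_rel e [:: (s, false); (t, false)] [:: (t, false); (s, false)].

Definition racg (V : finType) (e : rel V) : groupType :=
  presented_group (racg_rel e).

(* ** Subgroups *)

Section Subgroups.
Variable G : groupType.
Implicit Types (A H : set G) (HH : set (set G)).

Definition is_subgroup H := H 1 /\ forall x y, H x -> H y -> H (x * y^-1).

Definition generated A : set G := smallest is_subgroup A.

Definition finitely_generated H := exists2 A, finite_set A & H = generated A.

Definition torsion_free H :=
  forall h n, H h -> (0 < n)%N -> h ^+ n = 1 -> h = 1.

Definition malnormal HH :=
  forall H H' g, HH H -> HH H' ->
    H `&` [set g * h * g^-1 | h in H'] <> [set 1] -> H = H' /\ H g.

End Subgroups.

(* ** Graphs, given by their adjacency relation *)

Section Graphs.
Variables (T : eqType) (e : rel T).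

(* The walk starting at x visits x and then the successive vertices of p; its
   length is [size p]. *)
Definition walk (x : T) (p : seq T) (y : T) := path e x p /\ last x p = y.

(* None stands for an infinite distance. *)
Definition gdist (x y : T) : option nat :=
  if pselect (exists n, `[< exists2 p, walk x p y & size p = n >]) is left h
  then Some (ex_minn h) else None.

Definition gdist_le (x y : T) (r : nat) :=
  if gdist x y is Some n then (n <= r)%N else false.

Definition geodesic (x : T) (p : seq T) (y : T) :=
  walk x p y /\ gdist x y = Some (size p).

(* Geodesic triangles are uniformly slim. Only the side p is constrained, but
   the sides are cyclically oriented x -> y -> z -> x, so that relabelling the
   vertices gives the condition on the two other sides. *)
Definition hyperbolic := exists delta : nat,
  forall x y z p q r, geodesic x p y -> geodesic y q z -> geodesic z r x ->
  forall u, u \in x :: p ->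
  exists2 v, (v \in y :: q) || (v \in z :: r) & gdist_le u v delta.

End Graphs.

(* ** Hyperbolically embedded collections *)

(* Letters coming from distinct pieces of the disjoint union of X and of the
   members of HH are distinct, even if they represent the same element. *)
Inductive letter (G : Type) : Type :=
| Base of G
| Periph of set G & G.
Arguments Base {G} _.
Arguments Periph {G} _ _.

Section HypEmbedded.
Variable G : groupType.
Implicit Types (X H : set G) (HH : set (set G)).

Definition alphabet X HH : set (letter G) :=
  fun a => match a with Base x => X x | Periph H h => HH H /\ H h end.

Definition letter_val (a : letter G) : G :=
  match a with Base x => x | Periph _ h => h end.

Definition cay_edge X HH (g : G) (a : letter G) (g' : G) :=
  alphabet X HH a /\ g' = g * letter_val a.

(* Edges are travelled in both directions. *)
Definition cay X HH : rel G := fun g g' =>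
  `[< exists a, cay_edge X HH g a g' \/ cay_edge X HH g' a g >].

Definition inner_edge H (g : G) (a : letter G) (g' : G) :=
  [/\ H g, H g' & exists h, a = Periph H h].

Definition outer_edge X HH H (g : G) (a : letter G) (g' : G) :=
  cay_edge X HH g a g' /\ ~ inner_edge H g a g'.

Definition outer_cay X HH H : rel G := fun g g' =>
  `[< exists a, outer_edge X HH H g a g' \/ outer_edge X HH H g' a g >].

Definition dhat X HH H : G -> G -> option nat := gdist (outer_cay X HH H).

Definition dhat_ball X HH H (h : G) (r : nat) : set G :=
  [set k | H k /\ exists2 n, dhat X HH H h k = Some n & (n <= r)%N].

Definition dhat_locally_finite X HH H :=
  forall h r, H h -> finite_set (dhat_ball X HH H h r).

Definition hyp_embedded HH := exists X : set G,
  [/\ generated (X `|` \bigcup_(H in HH) H) = setT,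
      hyperbolic (cay X HH)
    & forall H, HH H -> dhat_locally_finite X HH H].

End HypEmbedded.

(* Main.v *)
Require Import Defs.
From mathcomp Require Import all_boot.
From mathcomp Require Import all_classical.
From mathcomp Require Import ssralg ssrint zify.

(* Everything is read off the walls of the Davis complex, encoded as reflections
   (the conjugates of the generators); the distance of two elements is the number of
   walls that separate them.

   A proper malnormal subgroup H contains no z <> 1 that commutes with a reflection:
   otherwise that reflection, hence by connectedness a conjugate of every generator,
   lies in H.  So H acts freely on the walls, and similarly it meets trivially every
   conjugate of a special subgroup generated by a join.  When H is finitely generated,
   this bounds the projections of H to all cosets of star subgroups: an H-geodesic
   word crosses a given wall only in a time window of bounded length, so a large
   projection forces many points of H to lie near one coset of a join subgroup, and
   two of them differ by a nontrivial element of H in a conjugate of that subgroup.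

   Let X be the union of the star subgroups.  If a wall separates x from y, every path
   of Cay(G, X u H) from x to y has an edge that crosses it, and all points next to
   that wall are close to each other in this graph.  Hence the vertices of a word
   geodesic are close to every path with the same endpoints, and the graph is
   hyperbolic.  The number of walls that separate two points of H and are crossed by
   an edge outside H is bounded: by the projection bound for a letter of X, and by
   malnormality and a pigeonhole argument for a letter of another coset.  This gives
   the local finiteness.  If G itself belongs to the collection, the other members are
   trivial and the empty X works.

   Conversely, let f <> 1 be in the intersection of H and of k H' k^-1, with k of
   minimal length in its double coset.  The powers f^n k = k c^n give paths of bounded
   length from 1 to f^n through k and k c^n which avoid the edges of H, unless H = H'
   contains k; local finiteness then forces f to have finite order. *)

Set Implicit Arguments.
Unset Strict Implicit.
Unset Printing Implicit Defensive.

Local Open Scope classical_set_scope.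
Local Open Scope group_scope.

(** * Counting *)

(** Stated on duplicate-free lists, so that neither finiteness nor an enumeration of [P] has to be
    known beforehand. *)
Definition at_most (T : eqType) (P : T -> Prop) (n : nat) :=
  forall s : seq T, uniq s -> (forall t, t \in s -> P t) -> (size s <= n)%N.

Lemma at_most_sub (T : eqType) (P Q : T -> Prop) m n :
  (forall t, P t -> Q t) -> (m <= n)%N -> at_most Q m -> at_most P n.
Proof.
by move=> PQ mn Qm s us sP; apply: leq_trans mn; apply: Qm => // t /sP /PQ.
Qed.

Lemma at_most_seq (T : eqType) (l : seq T) (P : T -> Prop) :
  (forall t, P t -> t \in l) -> at_most P (size l).
Proof. by move=> Pl s us sP; apply: uniq_leq_size => // t /sP /Pl. Qed.

Lemma at_most_or (T : eqType) (P Q : T -> Prop) m n :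
  at_most P m -> at_most Q n -> at_most (fun t => P t \/ Q t) (m + n).
Proof.
move=> Pm Qn s us sPQ.
rewrite -(count_predC (fun t => `[< P t >]) s) -!size_filter.
apply: leq_add; [apply: Pm | apply: Qn]; rewrite ?filter_uniq //.
  by move=> t; rewrite mem_filter => /andP[/asboolP].
move=> t; rewrite mem_filter /= => /andP[/asboolPn nP ts].
by case: (sPQ t ts).
Qed.

Lemma at_most_ex (T : eqType) (Q : nat -> T -> Prop) n K :
  (forall i, (i < n)%N -> at_most (Q i) K) ->
  at_most (fun t => exists2 i, (i < n)%N & Q i t) (n * K).
Proof.
elim: n => [|n IH] Qn.
  by case=> [|x s] // _ /(_ x (mem_head _ _)) [].
rewrite mulSn; apply: (@at_most_sub _ _
  (fun t => Q n t \/ exists2 i, (i < n)%N & Q i t) _ _ _ (leqnn _)).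
  move=> t [i]; rewrite ltnS leq_eqVlt => /orP[/eqP-> | lin] Qt; first by left.
  by right; exists i.
by apply: at_most_or; [apply: Qn | apply: IH => i lin; apply: Qn; lia].
Qed.

(** [f] is a relation rather than a function, so that the partner [u] of [t] may come from a mere
    existence statement. *)
Lemma at_most_rel (T U : eqType) (P : T -> Prop) (Q : U -> Prop)
    (f : T -> U -> Prop) n :
  (forall t, P t -> exists2 u, Q u & f t u) ->
  (forall t t' u, P t -> P t' -> f t u -> f t' u -> t = t') ->
  at_most Q n -> at_most P n.
Proof.
move=> fP f_inj Qn s us sP.
suff [s' [us' <- s'P]] : exists s', [/\ uniq s', size s' = size s &
    forall u, u \in s' -> Q u /\ exists2 t, t \in s & f t u].
  by apply: Qn => // u /s'P[].
elim: s us sP => [|t s IH] /=; first by exists [::].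
move=> /andP[ts us] sP.
have [|s' [us' sz s'P]] := IH us.
  by move=> t' t's; apply: sP; rewrite in_cons t's orbT.
have [u Qu ftu] := fP t (sP t (mem_head _ _)).
exists (u :: s'); split => /=; last 2 first.
- by rewrite sz.
- move=> u'; rewrite in_cons => /orP[/eqP->|/s'P[Qu' [t' t's ft']]].
    by split=> //; exists t; rewrite ?mem_head.
  by split=> //; exists t' => //; rewrite in_cons t's orbT.
rewrite us' andbT; apply: contra ts => /s'P[_ [t' t's ft']].
suff -> : t = t' by [].
by apply: (f_inj t t' u) => //; apply: sP; rewrite in_cons ?eqxx ?t's ?orbT.
Qed.

Lemma finite_max (T : choiceType) (A : set T) (P : T -> nat -> Prop) :
  finite_set A -> (forall x m n, (m <= n)%N -> P x m -> P x n) ->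
  (forall x, A x -> exists n, P x n) -> exists n, forall x, A x -> P x n.
Proof.
move=> /finite_seqP[s ->] Pmono Pex.
elim: s Pex => [|x s IH] Pex; first by exists 0%N.
have [|n nP] := IH; first by move=> y ys; apply: Pex; rewrite /= in_cons ys orbT.
have [m mP] := Pex x (mem_head _ _).
exists (m + n)%N => y /=; rewrite in_cons => /orP[/eqP->|/nP].
  by apply: Pmono mP; rewrite leq_addr.
by apply: Pmono; rewrite leq_addl.
Qed.

Lemma discrete_ivt (f : nat -> nat) n K v :
  (forall i, (i < n)%N -> (f i.+1 <= f i + K)%N) -> (f 0 < v)%N -> (v <= f n)%N ->
  exists2 i, (i <= n)%N & (v <= f i < v + K)%N.
Proof.
move=> fK f0 fn.
have ex : exists i, (v <= f i)%N by exists n.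
case: (ex_minnP ex) => -[|i] vi imin; first by move: vi; rewrite leqNgt f0.
have lin : (i.+1 <= n)%N by exact: imin.
exists i.+1 => //; rewrite vi /=.
have : ~~ (v <= f i)%N by apply/negP => /imin; rewrite ltnn.
by have := fK i lin; lia.
Qed.

(** * Walls of right-angled Coxeter groups *)

Section Walls.
Variables (V : finType) (e : rel V).
Local Notation G := (racg e).
Implicit Types (s t u : V) (w : seq V) (g h k x y z : G).

Definition gen s : G := @pg_class V (racg_rel e) [:: (s, false)].

Fixpoint ev w : G := if w is s :: w' then gen s * ev w' else 1.

(* The walls crossed by the edge path labelled by [w] and issued from [1], each
   wall being encoded as the reflection that fixes it. *)
Fixpoint walls w : seq G :=
  if w is s :: w' then gen s :: [seq r ^ gen s | r <- walls w'] else [::].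

Lemma walls_cons s w :
  walls (s :: w) = gen s :: [seq r ^ gen s | r <- walls w].
Proof. by []. Qed.

Lemma ev_cat w1 w2 : ev (w1 ++ w2) = ev w1 * ev w2.
Proof. by elim: w1 => [|s w1 IH] /=; rewrite ?mul1g // IH mulgA. Qed.

Lemma genK s : gen s * gen s = 1.
Proof.
rewrite /gen -[_ * _]/(pg_mul _ _) pg_mulE.
by apply/pg_classP; apply: pres_rel; exact: racg_sq.
Qed.

Lemma gen_inv s : (gen s)^-1 = gen s.
Proof. by apply: mulg1_eq; rewrite genK. Qed.

Lemma gen_mulK s x : gen s * (gen s * x) = x.
Proof. by rewrite mulgA genK mul1g. Qed.

Lemma conj_genK s : involutive (fun x => x ^ gen s).
Proof. by move=> x; rewrite -conjgM genK conjg1. Qed.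

Lemma gen_comm s t : e s t -> gen s * gen t = gen t * gen s.
Proof.
move=> est; rewrite /gen -![_ * _]/(pg_mul _ _) !pg_mulE.
by apply/pg_classP; apply: pres_rel; exact: racg_comm.
Qed.

Lemma conj_gen_comm s t : e s t -> gen t ^ gen s = gen t.
Proof. by move=> /gen_comm est; rewrite conjgE gen_inv -est mulgA genK mul1g. Qed.

Lemma pg_class_ev (a : word V) : pg_class (racg_rel e) a = ev (map fst a) :> G.
Proof.
elim: a => [|[s b] a IH] //=.
rewrite -IH -cat1s -pg_mulE -[pg_mul _ _]/(_ * _ : G); congr (_ * _).
case: b => //; rewrite -gen_inv; symmetry; apply: mulg1_eq.
rewrite -[_ * _]/(pg_mul _ _) pg_mulE.
by apply/pg_classP; exact: (pres_cancel _ s false).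
Qed.

Lemma ev_surj g : exists w, g = ev w.
Proof. by exists (map fst (pg_repr g)); rewrite -pg_class_ev pg_reprK. Qed.

Lemma walls_cat w1 w2 :
  walls (w1 ++ w2) = walls w1 ++ [seq r ^ (ev w1)^-1 | r <- walls w2].
Proof.
elim: w1 => [|s w1 IH] /=.
  by rewrite -[LHS]map_id; apply: eq_map => r; rewrite invg1 conjg1.
rewrite IH map_cat -map_comp; congr (_ :: _ ++ _); apply: eq_map => r /=.
by rewrite -conjgM invgM gen_inv.
Qed.

Lemma size_walls w : size (walls w) = size w.
Proof. by elim: w => //= s w IH; rewrite size_map IH. Qed.

(** The parity of the crossings, unlike their number, depends only on the value of [w]. *)
Definition sepw w (r : G) := odd (count_mem r (walls w)).

Lemma count_conj (l : seq G) r g :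
  count_mem r [seq q ^ g^-1 | q <- l] = count_mem (r ^ g) l.
Proof.
rewrite count_map; apply: eq_count => q /=.
by rewrite -(inj_eq (@conjg_inj _ g)) conjgKV.
Qed.

Lemma sepw_cat w1 w2 r :
  sepw (w1 ++ w2) r = sepw w1 r (+) sepw w2 (r ^ ev w1).
Proof. by rewrite /sepw walls_cat count_cat oddD count_conj. Qed.

(** The word [s s] crosses one wall twice, and [s t], [t s] cross the same two walls in opposite
    orders. *)
Lemma sepw_pres (a b : word V) : pres_eq (racg_rel e) a b ->
  forall r, sepw (map fst a) r = sepw (map fst b) r.
Proof.
elim=> {a b} [||a b c _ IH1 _ IH2|a a' b b' aa IH1 _ IH2|s b|_ _ [s|s t est]] //.
- by move=> r; rewrite IH1.
- move=> r; rewrite !map_cat !sepw_cat IH1 IH2 -!pg_class_ev.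
  by congr (_ (+) sepw _ (_ ^ _)); apply/pg_classP.
- by move=> r; rewrite /sepw /= conjgE mulKg addn0 oddD addbb.
- by move=> r; rewrite /sepw /= conjgE mulKg addn0 oddD addbb.
- move=> r; rewrite /sepw /= conj_gen_comm // {1}(_ : gen s = gen s ^ gen t); last first.
    by rewrite conjgE gen_inv gen_comm // gen_mulK.
  by rewrite !addn0 addnC.
Qed.

(** The wall [r] separates [1] from [g]; by [sepw_pres] the choice of the word does not matter. *)
Definition sep g (r : G) := sepw (map fst (pg_repr g)) r.

Lemma sep_ev w r : sep (ev w) r = sepw w r.
Proof.
pose a := [seq (s, false) | s <- w].
have aw : map fst a = w by rewrite -map_comp map_id.
have -> : ev w = pg_class (racg_rel e) a by rewrite pg_class_ev aw.
rewrite /sep -[in RHS]aw.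
exact/sepw_pres/pg_repr_class.
Qed.

Lemma sepM g h r : sep (g * h) r = sep g r (+) sep h (r ^ g).
Proof.
have [[w1 ->] [w2 ->]] := (ev_surj g, ev_surj h).
by rewrite -ev_cat !sep_ev sepw_cat.
Qed.

Lemma sep1 r : sep 1 r = false. Proof. exact: (sep_ev [::]). Qed.

Lemma sep_gen s r : sep (gen s) r = (r == gen s).
Proof.
by rewrite -[gen s]mulg1 (sep_ev [:: s]) /sepw /= addn0 mulg1 eq_sym oddb.
Qed.

Lemma gen_neq1 s : gen s != 1.
Proof. by apply/eqP => s1; have := sep_gen s (gen s); rewrite eqxx {1}s1 sep1. Qed.

End Walls.

(** * Reduced words, special subgroups and their gates *)

Section SpecialSubgroups.
Variables (V : finType) (e : rel V).
Local Notation G := (racg e).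
Implicit Types (s t u : V) (w : seq V) (L : pred V) (g h k x y z r : G).
Local Notation gen := (gen e).
Local Notation ev := (ev e).
Local Notation walls := (walls e).

Definition reduced w := uniq (walls w).

Lemma sep_reduced w r : reduced w -> sep (ev w) r = (r \in walls w).
Proof. by move=> uw; rewrite sep_ev /sepw count_uniq_mem // oddb. Qed.

Lemma sep_walls w r : sep (ev w) r -> r \in walls w.
Proof. by rewrite sep_ev /sepw -has_pred1 has_count; case: count. Qed.

(** The strong exchange condition: reflecting the part of the path after the crossing deletes the
    letter that crosses [r]. *)
Lemma exchange w r : r \in walls w ->
  exists w', [/\ size w = (size w').+1, {subset w' <= w} & r * ev w = ev w'].
Proof.
elim: w r => //= s w IH r; rewrite in_cons => /orP[/eqP->|/mapP[q /IH]].
  exists w; split=> //; last by rewrite gen_mulK.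
  by move=> t tw; rewrite in_cons tw orbT.
move=> [w' [sz sub ew]] ->; exists (s :: w'); split; first by rewrite /= sz.
  by move=> t; rewrite !in_cons => /orP[->//|/sub->]; rewrite orbT.
by rewrite /= -ew conjgE gen_inv -!mulgA gen_mulK.
Qed.

(** If a wall is crossed twice, reflecting the stretch between the two crossings deletes two
    letters. *)
Lemma shorten_nonreduced w : ~~ reduced w ->
  exists w', [/\ (size w' < size w)%N, {subset w' <= w} & ev w = ev w'].
Proof.
elim: w => //= s w IH; rewrite /reduced /= negb_and negbK map_inj_uniq; last first.
  by apply: (can_inj (@conj_genK _ e s)).
case/orP=> [/mapP[q qw sq]|/IH[w' [sz sub ew]]].
  have {sq} qs : q = gen s by rewrite -[q](@conj_genK _ e s) /= -sq conjgE mulKg.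
  rewrite qs in qw; have [w' [sz sub ew]] := exchange qw.
  exists w'; split=> //=; first by rewrite sz; lia.
  by move=> t /sub tw; rewrite in_cons tw orbT.
exists (s :: w'); split; rewrite /= ?ltnS //; last by rewrite ew.
by move=> t; rewrite !in_cons => /orP[->//|/sub->]; rewrite orbT.
Qed.

Lemma reduce w :
  exists w', [/\ reduced w', (size w' <= size w)%N, {subset w' <= w} & ev w = ev w'].
Proof.
have [n] := ubnP (size w); elim: n w => // n IH w wn.
have [rw|/shorten_nonreduced[w1 [sz sub ew]]] := boolP (reduced w).
  by exists w; split.
have [|w' [rw' sz' sub' ew']] := IH w1; first by lia.
exists w'; split=> //; first by lia.
  by move=> t /sub' /sub.
by rewrite ew.
Qed.

Lemma reduced_ev g : exists2 w, reduced w & g = ev w.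
Proof. by have [w ->] := ev_surj g; have [w' []] := reduce w; exists w'. Qed.

Lemma reduced_cons s w : reduced (s :: w) = (gen s \notin walls w) && reduced w.
Proof.
have inj := can_inj (@conj_genK _ e s).
rewrite /reduced /= map_inj_uniq //; congr (~~ _ && _).
have E := mem_map inj (walls w) (gen s); rewrite /= conjgE mulKg in E.
by rewrite E.
Qed.

Definition ball n : seq G :=
  [seq ev w | w <- flatten [seq [seq tval w | w : i.-tuple V] | i <- iota 0 n.+1]].

Lemma mem_ball n g : at_most (fun r => sep g r) n -> g \in ball n.
Proof.
have [w rw ->] := reduced_ev g => /(_ (walls w) rw) wn.
apply: map_f; apply/flattenP; exists [seq tval w' | w' : (size w).-tuple V].
  apply/mapP; exists (size w) => //; rewrite mem_iota add0n ltnS /= -(size_walls e).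
  by apply: wn => r; rewrite sep_reduced.
by apply/mapP; exists (in_tuple w) => //; rewrite mem_enum.
Qed.

Definition special L g := exists2 w, all L w & g = ev w.

Lemma special1 L : special L 1. Proof. by exists [::]. Qed.

Lemma special_gen L s : L s -> special L (gen s).
Proof. by move=> Ls; exists [:: s]; rewrite /= ?Ls ?mulg1. Qed.

Lemma specialM L g h : special L g -> special L h -> special L (g * h).
Proof. by move=> [v Lv ->] [w Lw ->]; exists (v ++ w); rewrite ?all_cat ?Lv ?ev_cat. Qed.

Lemma specialV L g : special L g -> special L g^-1.
Proof.
move=> [w Lw ->]; elim: w Lw => [_|s w IH /= /andP[Ls /IH Lw]].
  by rewrite invg1; exact: special1.
by rewrite invgM gen_inv; apply: specialM Lw (special_gen Ls).
Qed.

Lemma specialJ L g h : special L g -> special L h -> special L (g ^ h).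
Proof. by move=> Lg Lh; apply/specialM/specialM => //; apply: specialV. Qed.

Lemma special_sub L L' g : subpred L L' -> special L g -> special L' g.
Proof. by move=> LL [w Lw ->]; exists w => //; apply: sub_all Lw. Qed.

Lemma special_reduced L g : special L g -> exists w, [/\ all L w, reduced w & g = ev w].
Proof.
move=> [w Lw ->]; have [w' [rw' _ sub ->]] := reduce w; exists w'; split=> //.
by apply/allP => t /sub; move/allP: Lw; apply.
Qed.

Lemma walls_split w r : r \in walls w ->
  exists w1 s w2, w = w1 ++ s :: w2 /\ r = gen s ^ (ev w1)^-1.
Proof.
elim: w r => //= s w IH r; rewrite in_cons => /orP[/eqP->|].
  by exists [::], s, w; rewrite invg1 conjg1.
case/mapP=> q /IH[w1 [t [w2 [-> ->]]]] ->; exists (s :: w1), t, w2; split=> //=.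
by rewrite -conjgM invgM gen_inv.
Qed.

Lemma special_walls L w r : all L w -> r \in walls w -> special L r.
Proof.
move=> Lw /walls_split[w1 [s [w2 [ew ->]]]]; move: Lw; rewrite ew all_cat /=.
case/and3P=> Lw1 Ls _; apply: specialJ; first exact: special_gen.
by apply: specialV; exists w1.
Qed.

Lemma special_sep L g r : special L g -> sep g r -> special L r.
Proof. by move=> [w Lw ->] /sep_walls; apply: special_walls. Qed.

Lemma sep_refl g r : sep g r -> exists s k, r = gen s ^ k.
Proof.
have [w ->] := ev_surj g => /sep_walls /walls_split[w1 [s [_ [_ ->]]]].
by exists s, (ev w1)^-1.
Qed.

(* [k] is the point of the special subgroup closest to [x]. *)
Lemma gate L x :
  exists2 k, special L k & forall r, special L r -> ~~ sep (k^-1 * x) r.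
Proof.
pose P n := `[< exists k w, [/\ special L k, k^-1 * x = ev w & size w = n] >].
have exP : exists n, P n.
  have [w ew] := ev_surj x; exists (size w); apply/asboolP; exists 1, w.
  by split=> //; [exact: special1 | rewrite invg1 mul1g].
case: (ex_minnP exP) => n /asboolP[k [w [Lk kx szw]]] nmin.
exists k => // r Lr; apply/negP; rewrite kx => /sep_walls /exchange[w' [sz _ ew']].
(* The reflection moves [k] to a point of the subgroup that a shorter word joins to [x]. *)
have /nmin : P (size w').
  apply/asboolP; exists (k * r^-1), w'; split=> //.
    by apply: specialM => //; apply: specialV.
  by rewrite -ew' -kx invgM invgK mulgA.
by rewrite -szw sz ltnn.
Qed.

Lemma gate_sep L x k r : special L r -> special L k ->
  (forall r, special L r -> ~~ sep (k^-1 * x) r) -> sep x r = sep k r.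
Proof.
move=> Lr Lk kP; rewrite -{1}(mulVKg k x) sepM.
by rewrite (negbTE (kP _ _)) ?addbF //; apply: specialJ.
Qed.

(** Involutions that commute along the edges of the graph define an action of [G], which serves to
    tell elements apart. *)
Lemma ev_inv (T : Type) (f : V -> T -> T) w1 w2 c :
  (forall s, involutive (f s)) ->
  (forall s t c, e s t -> f s (f t c) = f t (f s c)) ->
  ev w1 = ev w2 -> foldr f c w1 = foldr f c w2.
Proof.
move=> fK fC.
pose a w := [seq (s, false) | s <- w].
have aw w : map fst (a w) = w by rewrite -map_comp map_id.
rewrite -{1}(aw w1) -{1}(aw w2) -!pg_class_ev => /pg_classP.
rewrite -{2}(aw w1) -{2}(aw w2); move: (a w1) (a w2) c => a1 a2 c h.
elim: h c => {w1 w2 a1 a2} [||b1 b2 b3 _ IH1 _ IH2|b1 b1' b2 b2' _ IH1 _ IH2|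
  s b|_ _ [s|s t est]] //=.
- by move=> c; rewrite IH1.
- by move=> c; rewrite !map_cat !foldr_cat IH2 IH1.
- by move=> c; exact: fK.
- by move=> c; exact: fK.
- by move=> c; exact: fC.
Qed.

Lemma gen_inj : injective gen.
Proof.
(* [G] acts on [bool] through the parity of the letter [s]. *)
move=> s t st; pose f u (b : bool) := (u == s) (+) b.
have : foldr f false [:: s] = foldr f false [:: t].
  apply: ev_inv; last by rewrite /= st.
    by move=> u b; rewrite /f addbA addbb.
  by move=> u v b _; rewrite /f addbCA.
by rewrite /f /= eqxx addbF; case: eqP.
Qed.

Lemma gen_mul_infinite_order s t n : s != t -> ~~ e s t -> ~~ e t s ->
  (gen s * gen t) ^+ n.+1 != 1.
Proof.
move=> st nst nts; apply/eqP => h.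
(* [s] and [t] act as the reflections of the integers about [0] and [1/2], the other generators
   trivially; [s t] is then the translation by [-1]. *)
pose f u (i : int) : int :=
  (if u == s then - i else if u == t then 1 - i else i)%R.
pose w n := flatten (nseq n [:: s; t]).
have ew m : ev (w m) = (gen s * gen t) ^+ m.
  by elim: m => //= m IH; rewrite expgS -IH mulgA.
have fw m : foldr f 0%R (w m) = (- m%:Z)%R.
  by elim: m => //= m ->; rewrite /f !eqxx eq_sym (negbTE st); lia.
have : foldr f 0%R (w n.+1) = foldr f 0%R [::].
  apply: ev_inv; last by rewrite ew h.
    by move=> u i; rewrite /f; case: (u == s); [|case: (u == t)];
      rewrite ?GRing.opprK ?GRing.subKr.
  move=> u v i euv; rewrite /f.
  move: euv; case: (u =P s) => [->|_]; case: (v =P s) => [->|_] //.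
  - by case: (v =P t) => [->|] //; rewrite (negbTE nst).
  - by case: (u =P t) => [->|] //; rewrite (negbTE nts).
  - by case: (u =P t); case: (v =P t).
by rewrite fw.
Qed.

End SpecialSubgroups.

(** * Descents, centralizers of reflections, and crossing walls *)

Section Crossing.
Variables (V : finType) (e : rel V).
Hypothesis e_sym : symmetric e.
Local Notation G := (racg e).
Implicit Types (s t u : V) (w : seq V) (L : pred V) (g h k x y z r q : G).
Local Notation gen := (gen e).
Local Notation ev := (ev e).
Local Notation walls := (walls e).
Local Notation reduced := (reduced e).

Lemma alternate_shift s t n :
  ((gen t * gen s) ^+ n * gen t) ^ gen s = (gen s * gen t) ^+ n.+1 * gen s.
Proof.
rewrite conjgE gen_inv !mulgA; congr (_ * _).
elim: n => [|n IH]; first by rewrite expg0 expg1 mulg1.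
by rewrite [in RHS]expgS -IH [in LHS]expgS !mulgA.
Qed.

(** A reduced word in [s] and [t] alternates, so removing its first letter exchanges their roles. *)
Lemma dihedral_walls s t w r : all (pred2 s t) (s :: w) -> reduced (s :: w) ->
  r \in walls (s :: w) -> exists n, r = (gen s * gen t) ^+ n * gen s.
Proof.
elim: w s t r => [|v w IH] s t r; rewrite walls_cons in_cons.
  by move=> _ _ /orP[/eqP->|//]; exists 0%N; rewrite mul1g.
move=> Lw rw /orP[/eqP->|]; first by exists 0%N; rewrite mul1g.
have := rw; rewrite reduced_cons => /andP[sw rw'].
have vs : v != s by apply: contraNneq sw => <-; rewrite mem_head.
have vt : v = t by move: Lw => /= /and3P[_ /orP[/eqP vs'|/eqP//]]; rewrite vs' eqxx in vs.
subst v; case/mapP => q qw ->.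
have Lw' : all (pred2 t s) (t :: w).
  by apply/allP=> u uw; move/allP: Lw => /(_ u); rewrite in_cons uw orbT /= orbC; apply.
by have [n ->] := IH t s q Lw' rw' qw; exists n.+1; rewrite alternate_shift.
Qed.

(** At the gate of [g] in the subgroup of [s] and [t], both generators are walls of one alternating
    word; without an edge this would make a positive power of their product trivial. *)
Lemma descents_adjacent g s t :
  sep g (gen s) -> sep g (gen t) -> s != t -> e s t.
Proof.
move=> gs gt st; apply/negPn/negP => nst.
have nts : ~~ e t s by rewrite e_sym.
have [k Lk kP] := gate (pred2 s t) g.
have Ls : special (pred2 s t) (gen s) by apply: special_gen; rewrite /= eqxx.
have Lt : special (pred2 s t) (gen t) by apply: special_gen; rewrite /= eqxx orbT.
move: gs gt; rewrite !(gate_sep _ Lk kP) //.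
have [[|v w] [Lw rw ->]] := special_reduced Lk; first by rewrite sep1.
rewrite !sep_reduced // => sw tw.
have [vs|vt] : v = s \/ v = t by move: Lw => /= /andP[/orP[]/eqP->]; [left|right].
  subst v; have [n tE] := dihedral_walls Lw rw tw.
  have /eqP[] := gen_mul_infinite_order n st nst nts.
  by rewrite expgSr mulgA -tE genK.
subst v; have [|n sE] := @dihedral_walls t s w _ _ rw sw.
  by apply/allP=> u uw; move/allP: Lw => /(_ u uw); rewrite /= orbC.
have /eqP[] : (gen t * gen s) ^+ n.+1 != 1.
  by apply: gen_mul_infinite_order; rewrite // eq_sym.
by rewrite expgSr mulgA -sE genK.
Qed.

Definition star s : pred V := [pred t | (t == s) || e s t].

Lemma star_commute s g : special (star s) g -> g * gen s = gen s * g.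
Proof.
move=> [w Lw ->]; elim: w Lw => [_|t w IH /= /andP[st /IH Ew]].
  by rewrite mul1g mulg1.
rewrite -mulgA Ew !mulgA; congr (_ * _).
by case/orP: st => [/eqP->//|/gen_comm->].
Qed.

(** Induction on length: if [s] is a descent of [k] it is stripped; otherwise the first letter of
    [k] is adjacent to [s] and is stripped instead. *)
Lemma centralizer_gen s t k : k * gen t = gen s * k ->
  s = t /\ special (star s) k.
Proof.
have [w ->] := ev_surj k.
have [n] := ubnP (size w); elim: n w => // n IH w0 w0n.
have [w [rw sz _ ->]] := reduce e w0 => kst.
have [sw|sw] := boolP (gen s \in walls w).
  have [w' [sz' _ ew']] := exchange sw.
  have [||st sp] := IH w'; first by lia.
    by rewrite -ew' -mulgA kst.
  subst t; split=> //; rewrite -(gen_mulK s (ev w)) ew'; apply: specialM => //.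
  by apply: special_gen; rewrite /star /= eqxx.
case: w rw sz kst sw => [|c w] rw sz.
  by rewrite /= mul1g mulg1 => /gen_inj -> _; split=> //; exact: special1.
set k1 := ev (c :: w) => kst sw.
have sk : sep k1 (gen s) = false by rewrite sep_reduced //; exact: negbTE.
have ck : sep k1 (gen c) by rewrite sep_reduced // mem_head.
have cs : c != s by apply: contraNneq sw => <-; rewrite mem_head.
(* [s] and [c] are both descents of [gen s * k1 = k1 * gen t]. *)
have sc : e s c.
  apply: (@descents_adjacent (gen s * k1)); last by rewrite eq_sym.
    by rewrite sepM sep_gen eqxx conjgE mulKg sk.
  rewrite -kst sepM ck sep_gen; apply: contraNneq cs => ct.
  apply/eqP/(@gen_inj _ e); rewrite -(conjgK k1 (gen c)) ct conjgE invgK mulgA kst.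
  by rewrite -mulgA mulgV mulg1.
have [||st sp] := IH w; first by move: sz => /=; lia.
  by apply: (mulgI (gen c)); rewrite !mulgA -[_ * ev w]/k1 kst -(gen_comm sc) -mulgA.
by subst t; split=> //; apply: specialM sp; apply: special_gen; rewrite /star /= sc orbT.
Qed.

(** [gen s ^ x^-1] is the wall crossed by the edge from [x] to [x * gen s]; two edges crossing one
    wall differ by an element that conjugates one generator to the other. *)
Lemma same_wall s t x y : gen s ^ x^-1 = gen t ^ y^-1 ->
  s = t /\ special (star s) (x^-1 * y).
Proof.
rewrite !conjgE !invgK => E; apply: centralizer_gen.
by apply: (mulgI x); apply: (mulIg y^-1); rewrite -!mulgA !mulVKg mulgV mulg1 -E.
Qed.

(* Halfspaces that avoid [1] and meet contain a common neighbour of [1]. *)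
Lemma common_descent x y r : sep x r -> sep y r ->
  exists2 u, sep x (gen u) & sep y (gen u).
Proof.
have [w rw ->] := reduced_ev x; rewrite sep_reduced //.
elim: w rw y r => // s w IH rw y r; have := rw; rewrite reduced_cons => /andP[sw rw'].
have [ys _ _|ys] := boolP (sep y (gen s)).
  by exists s; rewrite // sep_reduced // mem_head.
rewrite in_cons => /orP[/eqP->|/mapP[q qw ->] yq]; first by rewrite (negbTE ys).
have qs : q != gen s by apply: contraNneq sw => <-.
have [||u wu yu] := IH rw' (gen s * y) q; rewrite ?sepM ?sep_gen ?(negbTE qs) //.
have us : u != s by apply: contraTneq wu => ->; rewrite sep_reduced.
have esu : e s u.
  apply: (@descents_adjacent (gen s * y)) => //; last by rewrite eq_sym.
  by rewrite sepM sep_gen eqxx conjgE mulKg (negbTE ys).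
move: yu; rewrite sepM sep_gen (inj_eq (@gen_inj _ _)) (negbTE us) conj_gen_comm // => yu.
by exists u; rewrite //= sepM sep_gen (inj_eq (@gen_inj _ _)) (negbTE us) conj_gen_comm.
Qed.

(** The first letter of [w] is a descent of [x] besides [u], hence adjacent to [u], and [u] remains
    a descent once it is removed. *)
Lemma descent_letters u w x : reduced w -> u \notin w -> sep x (gen u) ->
  (forall r, r \in walls w -> sep x r) -> all (e u) w.
Proof.
elim: w x => //= s w IH x; rewrite reduced_cons in_cons negb_or.
case/andP=> sw rw /andP[us uw] xu xw.
have xs : sep x (gen s) by apply: xw; rewrite mem_head.
have eus : e u s by apply: descents_adjacent xu xs us.
rewrite eus; apply: (IH (gen s * x)) => // [|r rw'].
  by rewrite sepM sep_gen (inj_eq (@gen_inj _ _)) (negbTE us) conj_gen_comm // e_sym.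
have rs : r != gen s by apply: contraNneq sw => <-.
rewrite sepM sep_gen (negbTE rs) xw //.
by rewrite in_cons (map_f (fun q => q ^ gen s)) ?orbT.
Qed.

(** By [descent_letters], the gate of [x] is a word in letters of [L] adjacent to [u]. This passage
    to a subset of [L] drives the induction of [proj_dist_bound_card]. *)
Lemma special_descent u L x r : ~~ L u -> sep x (gen u) -> special L r -> sep x r ->
  special [predI L & e u] r.
Proof.
move=> Lu xu Lr; have [k Lk kP] := gate L x.
have [w [Lw rw ek]] := special_reduced Lk.
rewrite (gate_sep Lr Lk kP) ek sep_reduced //; apply: special_walls.
rewrite all_predI Lw; apply: (descent_letters rw _ xu).
  by apply: contra Lu => uw; move/allP: Lw; apply.
move=> q qw; rewrite (gate_sep _ Lk kP) ?ek ?sep_reduced //.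
exact: special_walls qw.
Qed.

Definition separates x y r := sep x r (+) sep y r.

Lemma separatesE x y r : separates x y r = sep (x^-1 * y) (r ^ x).
Proof. by rewrite /separates -{1}(mulVKg x y) sepM addbA addbb. Qed.

Lemma separates_mull g x y r : separates (g * x) (g * y) r = separates x y (r ^ g).
Proof. by rewrite !separatesE invgM -!mulgA mulKg -conjgM. Qed.

Lemma separatesC x y r : separates x y r = separates y x r.
Proof. exact: addbC. Qed.

Lemma separates_trans z x y r :
  separates x y r -> separates x z r || separates z y r.
Proof. by rewrite /separates; do 3!case: sep. Qed.

Lemma separates_special L x y r :
  special L (x^-1 * y) -> separates x y r -> special L (r ^ x).
Proof. by move=> Lxy; rewrite separatesE; apply: special_sep. Qed.

(** The edge from [p] to [p * gen s] crosses [r]; the last clause records that [p] lies on a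
    geodesic from [x] to [y]. *)
Lemma separates_edge L x y r : special L (x^-1 * y) -> separates x y r ->
  exists p s, [/\ L s, special L (x^-1 * p), r = gen s ^ p^-1 &
    forall q, separates x p q -> separates x y q].
Proof.
move=> /special_reduced[w [Lw rw xy]]; rewrite separatesE xy => /sep_walls /walls_split.
case=> w1 [s [w2 [ew rE]]]; move: Lw; rewrite ew all_cat /= => /and3P[Lw1 Ls _].
exists (x * ev w1), s; split=> //.
- by rewrite mulKg; exists w1.
- by rewrite invgM conjgM -rE conjgK.
move=> q; rewrite !separatesE mulKg xy (sep_reduced _ rw) => /sep_walls.
by rewrite ew walls_cat mem_cat => ->.
Qed.

Lemma separates_edgeT x y r : separates x y r ->
  exists p s, r = gen s ^ p^-1 /\ forall q, separates x p q -> separates x y q.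
Proof.
move=> /(@separates_edge predT)[|p [s [_ _ rE pP]]]; last by exists p, s.
by have [w ->] := ev_surj (x^-1 * y); exists w; rewrite ?all_predT.
Qed.

(** All four quadrants of [r] and [q] are occupied. Two edges cross [r] on opposite sides of [q];
    they differ by an element of a star subgroup, which then contains [q] up to conjugation. *)
Lemma quadrants_commute a b c d r q :
  separates a b r -> separates c d r -> ~~ separates a b q -> ~~ separates c d q ->
  separates a c q -> r * q = q * r.
Proof.
move=> /separates_edgeT[p [s [rE pP]]] /separates_edgeT[p' [s' [rE' pP']]] abq cdq acq.
have [_ sp] : s = s' /\ special (star s) (p^-1 * p').
  by apply: same_wall; rewrite -rE.
have ppq : separates p p' q.
  have /negP := abq; have /negP := cdq; move: acq (pP q) (pP' q).
  by rewrite /separates; do 6!case: sep => //=; intuition.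
have /star_commute E := separates_special sp ppq.
by apply: (@conjg_inj _ p); rewrite 2!conjMg rE conjgKV E.
Qed.

End Crossing.

(** * Subgroups and words in finitely many generators *)

Section Subgroup.
Variable G : groupType.
Implicit Types (H A : set G) (x y z g h : G) (w l : seq G).

Lemma subgroup1 H : is_subgroup H -> H 1. Proof. by case. Qed.

Lemma subgroupV H x : is_subgroup H -> H x -> H x^-1.
Proof. by move=> [H1 HV] Hx; rewrite -div1g; apply: HV. Qed.

Lemma subgroupM H x y : is_subgroup H -> H x -> H y -> H (x * y).
Proof.
by move=> sH Hx Hy; rewrite -(invgK y); apply: sH.2 => //; apply: subgroupV.
Qed.

Lemma malnormal_conj (HH : set (set G)) H H' z x : malnormal HH -> HH H -> HH H' ->
  H z -> H' (z ^ x) -> z <> 1 -> H = H' /\ H x.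
Proof.
move=> mal hH hH' Hz Hzx z1; apply: mal => // E; apply: z1.
suff : [set 1] z by [].
rewrite -E; split=> //; exists (z ^ x) => //.
by rewrite conjgE mulVKg mulgK.
Qed.

Definition gprod w : G := foldr (fun a g => a * g) 1 w.

Lemma gprod_cat w1 w2 : gprod (w1 ++ w2) = gprod w1 * gprod w2.
Proof. by elim: w1 => [|a w IH] /=; rewrite ?mul1g // IH mulgA. Qed.

Lemma gprod_in H w : is_subgroup H -> (forall a, a \in w -> H a) -> H (gprod w).
Proof.
move=> sH; elim: w => [_|a w IH wH] /=; first exact: subgroup1.
apply: subgroupM => //; first by apply: wH; rewrite mem_head.
by apply: IH => b bw; apply: wH; rewrite in_cons bw orbT.
Qed.

Lemma finitely_generated_words H : finitely_generated H ->
  exists2 l : seq G, (forall a, a \in l -> H a) &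
    forall h, H h -> exists2 w : seq G, {subset w <= l} & h = gprod w.
Proof.
(* Adding the inverses to the list allows words without exponents. *)
move=> [A /finite_seqP[l0 ->] ->]; pose l := l0 ++ [seq a^-1 | a <- l0].
exists l.
  move=> a al K [sK lK]; move: al; rewrite mem_cat => /orP[/lK//|/mapP[b /lK bK ->]].
  exact: subgroupV.
move=> h hA.
apply: (hA [set g | exists2 w : seq G, {subset w <= l} & g = gprod w]).
split; last first.
  move=> a al; exists [:: a]; last by rewrite /= mulg1.
  by move=> b; rewrite inE => /eqP->; rewrite mem_cat (al : a \in l0).
split=> [|_ _ [v vl ->] [w wl ->]]; first by exists [::].
exists (v ++ rev [seq a^-1 | a <- w]).
  move=> b; rewrite mem_cat mem_rev => /orP[/vl//|/mapP[c /wl cl ->]].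
  move: cl; rewrite !mem_cat => /orP[cl|/mapP[d dl ->]]; last by rewrite invgK dl.
  by rewrite (map_f (fun a : G => a^-1)) ?orbT.
rewrite gprod_cat; congr (_ * _); elim: w {wl} => [|a w IH] /=; first by rewrite invg1.
by rewrite rev_cons -cats1 gprod_cat -IH invgM /= mulg1.
Qed.

Lemma geodesic_word H l h :
  (forall h, H h -> exists2 w : seq G, {subset w <= l} & h = gprod w) -> H h ->
  exists w, [/\ {subset w <= l}, h = gprod w &
    forall w', {subset w' <= l} -> gprod w' = h -> (size w <= size w')%N].
Proof.
move=> lH /lH[w0 w0l hE].
pose P n := `[< exists w, [/\ {subset w <= l}, h = gprod w & size w = n] >].
have exP : exists n, P n by exists (size w0); apply/asboolP; exists w0.
case: (ex_minnP exP) => n /asboolP[w [wl hw szw]] nmin; exists w; split=> //.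
by move=> w' w'l hw'; rewrite szw; apply: nmin; apply/asboolP; exists w'.
Qed.

End Subgroup.

(** * Counting separating walls; projections to cosets *)

Section WallCounts.
Variables (V : finType) (e : rel V).
Local Notation G := (racg e).
Implicit Types (L : pred V) (g h x y z r : G) (w : seq G).

Lemma separating_walls x y :
  exists s : seq G, uniq s /\ forall r, (r \in s) = separates x y r.
Proof.
have [w rw xy] := reduced_ev (x^-1 * y).
exists [seq r ^ x^-1 | r <- walls e w]; split.
  by rewrite map_inj_uniq //; exact: conjg_inj.
move=> r; rewrite separatesE xy sep_reduced //.
by have := mem_map (@conjg_inj G x^-1) (walls e w) (r ^ x); rewrite /= conjgK.
Qed.

Definition wall_seq x y := sval (cid (separating_walls x y)).

Lemma mem_wall_seq x y r : (r \in wall_seq x y) = separates x y r.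
Proof. by rewrite /wall_seq; case: cid => s /= []. Qed.

Lemma wall_seq_uniq x y : uniq (wall_seq x y).
Proof. by rewrite /wall_seq; case: cid => s /= []. Qed.

(* The distance between the projections of [x] and [y] to the coset of
   [special L] through [g]. *)
Definition proj_dist g L x y :=
  size [seq r <- wall_seq x y | `[< special L (r ^ g) >]].

Lemma proj_dist_at_most g L x y n : (proj_dist g L x y <= n)%N ->
  at_most (fun r => separates x y r /\ special L (r ^ g)) n.
Proof.
move=> pn s us sP; apply: leq_trans pn; apply: uniq_leq_size => // r /sP[xr Lr].
by rewrite mem_filter mem_wall_seq xr andbT; apply/asboolP.
Qed.

Lemma at_most_proj_dist g L x y n (P : G -> Prop) :
  (forall r, separates x y r -> special L (r ^ g) -> P r) -> at_most P n ->
  (proj_dist g L x y <= n)%N.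
Proof.
move=> LP; apply; first by rewrite filter_uniq // wall_seq_uniq.
by move=> r; rewrite mem_filter mem_wall_seq => /andP[/asboolP Lr xr]; apply: LP.
Qed.

Lemma proj_dist_triangle g L x y z :
  (proj_dist g L x y <= proj_dist g L x z + proj_dist g L z y)%N.
Proof.
apply: at_most_proj_dist (at_most_or (proj_dist_at_most (leqnn _))
  (proj_dist_at_most (leqnn _))) => r /(@separates_trans _ _ z) /orP[] zr Lr.
  by left.
by right.
Qed.

Lemma separates_cross x w r : separates x (x * gprod w) r ->
  exists w1 a w2, w = w1 ++ a :: w2 /\ separates (x * gprod w1) (x * gprod w1 * a) r.
Proof.
elim: w x => [|a w IH] x /=; first by rewrite mulg1 /separates addbb.
move=> /(@separates_trans _ _ (x * a)) /orP[xr|].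
  by exists [::], a, w; rewrite /= mulg1.
rewrite mulgA => /IH[w1 [b [w2 [-> br]]]]; exists (a :: w1), b, w2; split=> //=.
by rewrite mulgA.
Qed.

End WallCounts.

(** * Subgroups acting freely on walls have bounded projections to star cosets *)

Section BoundedProjections.
Variables (V : finType) (e : rel V).
Hypothesis e_sym : symmetric e.
Local Notation G := (racg e).
Implicit Types (L : pred V) (s t u : V) (a b g h k x y z r p c : G) (w : seq G).
Local Notation gen := (gen e).

(** The common link of [L]. Together [L] and [perp L] generate the special subgroup of a join, and
    conjugation by it preserves [special L]. *)
Definition perp L : pred V := [pred t | [forall s, L s ==> e s t]].

Lemma special_perp_gen L a t : special L a -> perp L t -> a * gen t = gen t * a.
Proof.
move=> La /forallP pt; apply: star_commute; apply: special_sub La => s Ls.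
by rewrite /star /= e_sym (implyP (pt s)) ?orbT.
Qed.

Lemma special_perp_commute L a b :
  special L a -> special (perp L) b -> a * b = b * a.
Proof.
move=> La [w Lw ->]; elim: w Lw => [_|t w IH /= /andP[pt /IH E]].
  by rewrite mul1g mulg1.
by rewrite mulgA (special_perp_gen La pt) -!mulgA E.
Qed.

Lemma special_perp_conj L r k :
  special L r -> special [predU L & perp L] k -> special L (r ^ k).
Proof.
move=> Lr [w Lw ->]; elim: w r Lr Lw => [|t w IH] r Lr /=; first by rewrite conjg1.
case/andP=> /orP[Lt|pt] Lw; rewrite conjgM; apply: IH => //.
  by apply: specialJ => //; apply: special_gen.
suff -> : r ^ gen t = r by [].
by rewrite conjgE (special_perp_gen Lr pt) mulKg.
Qed.

Lemma special_join L z : special [predU L & perp L] z ->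
  exists a b, [/\ special L a, special (perp L) b & z = a * b].
Proof.
move=> [w Lw ->]; elim: w Lw => [_|t w IH /= /andP[Lt /IH[a [b [La pb ->]]]]].
  by exists 1, 1; split; rewrite ?mulg1 //; exact: special1.
case/orP: Lt => [Lt|pt].
  exists (gen t * a), b; split=> //; last by rewrite mulgA.
  exact: specialM (special_gen _ Lt) La.
exists a, (gen t * b); split=> //; first exact: specialM (special_gen _ pt) pb.
by rewrite !mulgA (special_perp_gen La pt).
Qed.

Variable H : set G.
Hypothesis H_sub : is_subgroup H.
Hypothesis H_free : forall z s k, H z -> (gen s ^ k) ^ z = gen s ^ k -> z = 1.
Hypothesis H_join : forall L g z, (exists s, L s) -> (exists t, perp L t) ->
  H z -> special [predU L & perp L] (z ^ g) -> z = 1.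

(** If [v] is outside [L], it is in [perp L] and [H_join] applies. Otherwise [L] and [perp L] lie in
    the star of [v], so [z] fixes a wall and [H_free] applies. *)
Lemma star_join_free v L g z : subpred L (star e v) -> (exists s, L s) -> H z ->
  special [predU L & perp L] (z ^ g) -> z = 1.
Proof.
move=> Lv Lne Hz Lz.
have [vL|vL] := boolP (L v); last first.
  apply: H_join Lne _ Hz Lz; exists v; apply/forallP => s; apply/implyP => Ls.
  have /orP[/eqP sv|] := Lv s Ls; last by rewrite e_sym.
  by rewrite -sv Ls in vL.
have /star_commute E : special (star e v) (z ^ g).
  apply: special_sub Lz => s /orP[/Lv//|/forallP/(_ v)/implyP/(_ vL)].
  by rewrite /star /= => ->; rewrite orbT.
apply: (@H_free z v g^-1) => //; apply: (@conjg_inj _ g).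
by rewrite conjgKV conjJg conjgKV conjgE -E mulKg.
Qed.

Variable l : seq G.
Hypothesis lH : forall a, a \in l -> H a.
Hypothesis H_words : forall h, H h -> exists2 w : seq G, {subset w <= l} & h = gprod w.

Lemma gprod_subset w : {subset w <= l} -> H (gprod w).
Proof. by move=> wl; apply: gprod_in => // a /wl /lH. Qed.

(* As [H] acts freely on the walls, it moves a given wall to another one in at
   most one way. *)
Lemma return_bound : exists R, forall h h' a b r, H h -> H h' -> a \in l -> b \in l ->
  separates h (h * a) r -> separates h' (h' * b) r ->
  exists m : seq G, [/\ {subset m <= l}, (size m <= R)%N & gprod m = h^-1 * h'].
Proof.
pose rs := flatten [seq wall_seq 1 a | a <- l].
have rsP a r : a \in l -> sep a r -> r \in rs.
  move=> al ar; apply/flattenP; exists (wall_seq 1 a); first by apply: map_f.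
  by rewrite mem_wall_seq separatesE invg1 mul1g conjg1.
pose A : set (G * G) := [set` [seq (q, q') | q <- rs, q' <- rs]].
pose P (qq : G * G) n := forall k, H k -> qq.1 ^ k = qq.2 ->
  exists m : seq G, [/\ {subset m <= l}, (size m <= n)%N & gprod m = k].
have [R RP] : exists R, forall qq, A qq -> P qq R.
  apply: finite_max; first exact: finite_seq.
    move=> qq m n mn Pm k Hk kq; have [w [wl wm wk]] := Pm k Hk kq.
    by exists w; split=> //; apply: leq_trans mn.
  move=> [q q'] /allpairsP[[q1 q2] /= [q1s _ [-> _]]].
  have [s [g qE]] : exists s g, q1 = gen s ^ g.
    case/flattenP: q1s => _ /mapP[a _ ->].
    by rewrite mem_wall_seq separatesE => /sep_refl[s [g]]; rewrite conjg1 => ->; exists s, g.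
  have [[k0 [Hk0 kq]]|nk] := pselect (exists k, H k /\ q1 ^ k = q'); last first.
    by exists 0%N => k Hk /= kq; case: nk; exists k.
  have [w wl k0w] := H_words Hk0; exists (size w) => k Hk /= kq'.
  exists w; split=> //; rewrite -k0w; symmetry; apply: divg1_eq.
  apply: (@H_free _ s g); first by apply: subgroupM => //; exact: subgroupV.
  by rewrite -qE conjgM kq' -kq conjgK.
exists R => h h' a b r Hh Hh' al bl.
rewrite !separatesE !mulKg => ar br.
apply: (RP (r ^ h, r ^ h')); last by rewrite /= -conjgM mulVKg.
  by apply/allpairsP; exists (r ^ h, r ^ h'); split; [exact: rsP al ar|exact: rsP bl br|].
by apply: subgroupM => //; apply: subgroupV.
Qed.

Lemma letter_bound : exists K, forall a x, a \in l ->
  at_most (fun r => separates x (x * a) r) K.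
Proof.
have [K KP] : exists K, forall a, [set` l] a -> at_most (fun r => sep a r) K.
  apply: finite_max; first exact: finite_seq.
    by move=> a m n mn; apply: at_most_sub mn.
  move=> a _; exists (size (wall_seq 1 a)); apply: at_most_seq => r ar.
  by rewrite mem_wall_seq separatesE invg1 mul1g conjg1.
exists K => a x al; apply: (at_most_rel (Q := fun r => sep a r)
  (f := fun r q => q = r ^ x)) (KP a al) => [r|r r' q _ _ ->].
  by rewrite separatesE mulKg => ar; exists (r ^ x).
exact: conjg_inj.
Qed.

(** * Induction step: from smaller subsets of a star to [L] *)

Section Step.
Variables (v : V) (L : pred V) (N K R : nat).
Hypothesis Lv : subpred L (star e v).
Hypothesis L_ne : exists s, L s.
Hypothesis N_proj : forall u g x y, ~~ L u -> ~~ perp L u -> H x -> H y ->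
  (proj_dist g [predI L & e u] x y <= N)%N.
Hypothesis K_walls : forall a x, a \in l -> at_most (fun r => separates x (x * a) r) K.
Hypothesis R_return : forall h h' a b r, H h -> H h' -> a \in l -> b \in l ->
  separates h (h * a) r -> separates h' (h' * b) r ->
  exists m : seq G, [/\ {subset m <= l}, (size m <= R)%N & gprod m = h^-1 * h'].

Local Notation F := [predU L & perp L].

(** Here [g * k] is the projection of [h] to the coset of [special F] through [g]. The lemma is
    applied with both endpoints of a geodesic as [a]. *)
Lemma far_separates g h a k r : H a -> H h -> special F k ->
  (forall r, special F r -> ~~ sep (k^-1 * (g^-1 * h)) r) ->
  (N < proj_dist g L a h)%N -> sep (k^-1 * (g^-1 * h)) r ->
  separates a h (r ^ (g * k)^-1).
Proof.
move=> Ha Hh Fk kP far; set c := k^-1 * _ in kP *; pose p := g * k => cr.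
have cE : c = p^-1 * h by rewrite /c /p invgM mulgA.
(* Otherwise the walls counted by [proj_dist g L a h] all cross the wall of a letter
   [u] outside [F], so they belong to a smaller special subgroup. *)
apply/negPn/negP => ahr; move: far; rewrite ltnNge => /negP; apply.
pose xa := p^-1 * a.
have sepE q : separates a h (q ^ p^-1) = sep xa q (+) sep c q.
  by rewrite cE -(separates_mull p^-1).
have xar : sep xa r by move: ahr; rewrite sepE cr addbT negbK.
have [u xu cu] := common_descent e_sym xar cr.
have Fu : ~~ F u by apply: contraTN cu => Fu; apply: kP; exact: special_gen.
have [Lu pu] : ~~ L u /\ ~~ perp L u by move: Fu => /=; rewrite negb_or => /andP[].
apply: leq_trans (N_proj p Lu pu Ha Hh).
apply: at_most_proj_dist (proj_dist_at_most (leqnn _)) => q aq Lq; split=> //.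
have Lqp : special L (q ^ p) by rewrite conjgM; apply: special_perp_conj.
apply: (special_descent e_sym Lu xu Lqp).
have := sepE (q ^ p); rewrite conjgK aq (negbTE (kP _ _)) ?addbF //.
by apply: special_sub Lqp => s Ls; apply/orP; left.
Qed.

(** If a wall is crossed in [u] and again in [w'], [R_return] replaces the stretch between the
    crossings by at most [R] letters. As [w] is minimal, the first crossing is among the last [R]
    letters of [u], each crossing at most [K] walls. *)
Lemma recent_walls x w (u w' : seq G) : H x -> {subset w <= l} ->
  (forall w' : seq G, {subset w' <= l} -> gprod w' = gprod w -> (size w <= size w')%N) ->
  w = u ++ w' ->
  at_most (fun r => separates x (x * gprod u) r /\
    separates (x * gprod u) (x * gprod w) r) (R * K).
Proof.
move=> Hx wl wmin wE.
(* The letters of [u] are numbered from its end. *)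
pose Q i r := separates (x * gprod (take (size u - i.+1) u))
  (x * gprod (take (size u - i) u)) r /\ (i < size u)%N.
have QR : at_most (fun r => exists2 i, (i < R)%N & Q i r) (R * K).
  apply: at_most_ex => i _.
  have [iu|iu] := leqP (size u) i.
    by case=> [|r rs] // _ /(_ r (mem_head _ _))[_]; rewrite ltnNge iu.
  have E : (size u - i)%N = (size u - i.+1).+1 by lia.
  have lt : (size u - i.+1 < size u)%N by lia.
  have al : nth 1 u (size u - i.+1) \in l.
    by apply: wl; rewrite wE mem_cat mem_nth.
  apply: at_most_sub (leqnn _) (@K_walls _ (x * gprod (take (size u - i.+1) u)) al) => r [].
  by rewrite E (take_nth 1) // -cats1 gprod_cat /= mulg1 mulgA.
apply: at_most_sub (leqnn _) QR => r [xr]; rewrite wE gprod_cat mulgA => yr.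
have [u1 [a [u2 [uE ar]]]] := separates_cross xr.
have [v1 [b [v2 [vE br]]]] := separates_cross yr.
have sub z : z \in u1 ++ a :: u2 ++ v1 ++ b :: v2 -> z \in l.
  by move=> zw; apply: wl; rewrite wE uE vE -catA.
have [||||m [ml mR mE]] := R_return _ _ _ _ ar br.
- by apply: subgroupM => //; apply: gprod_subset => z zu; apply: sub; rewrite mem_cat zu.
- apply: subgroupM; rewrite // -?mulgA -?gprod_cat; first apply: subgroupM => //.
    by apply: gprod_subset => z zu; apply: wl; rewrite wE mem_cat zu.
  by apply: gprod_subset => z zu; apply: wl; rewrite wE vE !mem_cat zu !orbT.
- by apply: sub; rewrite mem_cat mem_head orbT.
- by apply: sub; rewrite !(mem_cat, in_cons) eqxx !orbT.
have : (size w <= size (u1 ++ m ++ b :: v2))%N.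
  apply: wmin.
    move=> z; rewrite !mem_cat => /or3P[zu|/ml//|zv]; apply: sub.
      by rewrite mem_cat zu.
    by rewrite !(mem_cat, in_cons) -in_cons zv !orbT.
  rewrite wE !gprod_cat mE uE vE !gprod_cat /= !invgM -!mulgA !mulKg.
  by gsimpl; rewrite !mulgA.
rewrite wE uE vE !size_cat /= ?size_cat /= => sz.
exists (size u2).
  by move: sz mR; move: (size u1) (size u2) (size v1) (size v2) (size m) => *; lia.
have E1 : (size u - (size u2).+1)%N = size u1 by rewrite uE size_cat /=; lia.
have E2 : (size u - size u2)%N = size (rcons u1 a) by rewrite uE size_rcons size_cat /=; lia.
split; last by rewrite uE size_cat /=; lia.
rewrite E1 E2 uE take_size_cat // -cat_rcons take_size_cat // -cats1 gprod_cat.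
by rewrite /= mulg1 mulgA.
Qed.

(** By [far_separates], the walls between [x * gprod u] and its projection separate this point from
    both endpoints, so [recent_walls] counts them. *)
Lemma middle_near g x w (u w' : seq G) : H x -> {subset w <= l} ->
  (forall w' : seq G, {subset w' <= l} -> gprod w' = gprod w -> (size w <= size w')%N) ->
  w = u ++ w' ->
  (N < proj_dist g L x (x * gprod u))%N ->
  (N < proj_dist g L (x * gprod u) (x * gprod w))%N ->
  exists p c, [/\ special F (g^-1 * p), x * gprod u = p * c & c \in ball e (R * K)].
Proof.
move=> Hx wl wmin wE; set h := x * gprod u; set y := x * gprod w => xh hy.
have Hu : H (gprod u).
  by apply: gprod_subset => z zu; apply: wl; rewrite wE mem_cat zu.
have Hh : H h by apply: subgroupM.
have Hy : H y by apply: subgroupM => //; apply: gprod_subset.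
have [k Fk kP] := gate F (g^-1 * h).
exists (g * k), (k^-1 * (g^-1 * h)); split; rewrite ?mulKg //.
  by rewrite -mulgA mulVKg mulVKg.
apply: mem_ball; apply: (at_most_rel (f := fun r q => q = r ^ (g * k)^-1))
  (recent_walls Hx wl wmin wE) => [r cr|r r' q _ _ ->]; last exact: conjg_inj.
exists (r ^ (g * k)^-1) => //; split; first exact: far_separates.
rewrite separatesC; apply: far_separates => //.
apply: leq_trans hy _; apply: at_most_proj_dist (proj_dist_at_most (leqnn _)).
by move=> q; rewrite separatesC.
Qed.

(** Two points of [H] with the same offset [c] differ by an element of a conjugate of [special F],
    trivial by [star_join_free]. *)
Lemma at_most_near g : at_most (fun h => H h /\
  exists p c, [/\ special F (g^-1 * p), h = p * c & c \in ball e (R * K)])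
  (size (ball e (R * K))).
Proof.
apply: (at_most_rel (Q := fun c => c \in ball e (R * K))
  (f := fun h c => exists2 p, special F (g^-1 * p) & h = p * c)).
- by move=> h [_ [p [c [Fp hE cB]]]]; exists c => //; exists p.
- move=> h h' c [Hh _] [Hh' _] [p Fp hE] [p' Fp' hE'].
  apply: divg1_eq; apply: (@star_join_free v L g) => //.
    by apply: subgroupM => //; apply: subgroupV.
  suff -> : (h / h') ^ g = g^-1 * p * (g^-1 * p')^-1.
    by apply: specialM => //; apply: specialV.
  by rewrite hE hE' conjgE !invgM invgK !mulgA mulgK.
- exact: (at_most_seq (P := fun c => c \in ball e (R * K))).
Qed.

Lemma proj_dist_step : exists M, forall g x y, H x -> H y -> (proj_dist g L x y <= M)%N.
Proof.
pose B := size (ball e (R * K)).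
(* The margins [N.+1] keep the chosen points at projection distance more than [N] from [x] and [y];
   the [B.+1] disjoint windows of width [K] in between yield more near points than [at_most_near]
   allows. *)
exists (N.+1 + B.+1 * K + N.+1)%N => g x y Hx Hy.
rewrite leqNgt; apply/negP => far.
have [|w [wl wE wmin]] := @geodesic_word _ H l (x^-1 * y) H_words.
  by apply: subgroupM => //; apply: subgroupV.
have yE : y = x * gprod w by rewrite -wE mulVKg.
pose f i := proj_dist g L x (x * gprod (take i w)).
suff : (B.+1 <= B)%N by rewrite ltnn.
have BP : at_most (fun j => (j < B.+1)%N) B.
  apply: (at_most_rel (f := fun j h =>
    (N.+1 + j * K <= proj_dist g L x h < N.+1 + j * K + K)%N)) (@at_most_near g).
  - move=> j jB.
    have [|||i iw /andP[fi1 fi2]] := @discrete_ivt f (size w) K (N.+1 + j * K).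
    + move=> i iw; apply: leq_trans (proj_dist_triangle _ _ _ _ (x * gprod (take i w))) _.
      rewrite leq_add2l.
      apply: (at_most_proj_dist (P := fun r => separates (x * gprod (take i w))
        (x * gprod (take i w) * nth 1 w i) r)).
        by move=> r; rewrite (take_nth 1) // -cats1 gprod_cat /= mulg1 mulgA.
      by apply: K_walls; apply: wl; exact: mem_nth.
    + rewrite /f take0 /= mulg1 /proj_dist; apply: leq_trans (ltn0Sn _).
      by rewrite (_ : wall_seq x x = [::]) //; case E : (wall_seq x x) => // [r s];
        have := mem_wall_seq x x r; rewrite E mem_head /separates addbb.
    + rewrite /f take_size -yE; apply: leq_trans (ltnW far).
      by rewrite -addnA leq_add2l; apply: leq_trans (leq_addr _ _);
        rewrite leq_mul2r (ltnW jB) orbT.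
    exists (x * gprod (take i w)); last by rewrite fi1 fi2.
    have wE' : w = take i w ++ drop i w by rewrite cat_take_drop.
    split.
      by apply: subgroupM => //; apply: gprod_subset => z /mem_take /wl.
    have [|||p [c [Fp hE cB]]] := @middle_near g x w _ _ Hx wl _ wE'.
    + by move=> w' w'l E; apply: wmin => //; rewrite E.
    + by apply: leq_trans fi1; rewrite leq_addr.
    + rewrite -yE; have := proj_dist_triangle g L x y (x * gprod (take i w)).
      move: far fi2; rewrite -/(f i); move: (f i) (proj_dist _ _ _ _) (proj_dist _ _ _ _) => *.
      nia.
    by exists p, c.
  - move=> j j' h _ _ /andP[h1 h2] /andP[h1' h2']; nia.
rewrite -[X in (X <= _)%N](size_iota 0); apply: BP; first exact: iota_uniq.
by move=> j; rewrite mem_iota.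
Qed.

End Step.

(** [special L] is trivial, so [1] is the only candidate for [r], whence the crude bound 1. *)
Lemma proj_dist_empty L : ~ (exists s, L s) ->
  exists M, forall g x y, H x -> H y -> (proj_dist g L x y <= M)%N.
Proof.
move=> L0; exists 1%N => g x y _ _.
apply: (at_most_proj_dist (P := fun r => r \in [:: 1])); last first.
  by apply: (@at_most_seq _ [:: 1]).
move=> r _ [[|s w] /= Lw rE]; last by case: L0; exists s; case/andP: Lw.
by rewrite inE -(conjg_eq1 r g) rE.
Qed.

(** Induction on the size of [L]: when [u] is outside [perp L], the part of [L] adjacent to [u] is
    strictly smaller. *)
Lemma proj_dist_bound_card n v L : (#|L| <= n)%N -> subpred L (star e v) ->
  exists M, forall g x y, H x -> H y -> (proj_dist g L x y <= M)%N.
Proof.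
elim: n L => [|n IH] L Ln Lv; have [[s Ls]|L0] := pselect (exists s, L s);
  try exact: proj_dist_empty.
- by move: Ln; rewrite leqn0 => /eqP/card0_eq/(_ s); rewrite [s \in L]Ls.
- have [N NP] : exists N, forall u, [set: V] u ->
      forall g x y, ~~ L u -> ~~ perp L u -> H x -> H y ->
      (proj_dist g [predI L & e u] x y <= N)%N.
    apply: finite_max; first exact: finite_finset.
      by move=> u m k mk Pm g x y Lu pu Hx Hy; apply: leq_trans mk; apply: Pm.
    move=> u _.
    have [Fu|/norP[Lu pu]] := boolP (L u || perp L u).
      by exists 0%N => g x y Lu pu; move: Fu; rewrite (negbTE Lu) (negbTE pu).
    have [||M MP] := IH [predI L & e u].
    + rewrite -ltnS; apply: leq_trans Ln; apply: proper_card; apply/properP.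
      split; first by apply/fintype.subsetP => t /andP[].
      move: pu; rewrite negb_forall => /existsP[t]; rewrite negb_imply => /andP[Lt etu].
      exists t => //; rewrite inE /= negb_and; apply/orP; right.
      by rewrite -[_ \notin _]/(~~ e u t) e_sym.
    + by move=> t /andP[/Lv].
    by exists M => g x y _ _; exact: MP.
  have [[K KP] [R RP]] := (letter_bound, return_bound).
  by apply: (@proj_dist_step v L N K R) => //; [exists s | move=> u g x y; exact: NP].
Qed.

Lemma proj_dist_bound : exists M, forall v g x y, H x -> H y ->
  (proj_dist g (star e v) x y <= M)%N.
Proof.
have [M MP] : exists M, forall v, [set: V] v ->
    forall g x y, H x -> H y -> (proj_dist g (star e v) x y <= M)%N.
  apply: finite_max; first exact: finite_finset.
    by move=> v m n mn Pm g x y Hx Hy; apply: leq_trans mn; apply: Pm.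
  by move=> v _; apply: (@proj_dist_bound_card _ v _ (leqnn _)).
by exists M => v; apply: MP.
Qed.

End BoundedProjections.

(** * Malnormal collections and the walls shared by two cosets *)

Section Malnormal.
Variables (V : finType) (e : rel V).
Hypothesis e_sym : symmetric e.
Hypothesis e_conn : forall s t, connect e s t.
Local Notation G := (racg e).
Local Notation gen := (gen e).
Local Notation ev := (ev e).
Implicit Types (H : set G) (s t u : V) (a b g h k x y z r p c : G) (w : seq G).

Variable HH : set (set G).
Hypothesis HH_sub : forall H, HH H -> is_subgroup H.
Hypothesis HH_fg : forall H, HH H -> finitely_generated H.
Hypothesis HH_mal : malnormal HH.

Lemma malnormal_commute H z x : HH H -> H z -> z <> 1 -> z * x = x * z -> H x.
Proof.
move=> hH Hz z1 zx; apply: (malnormal_conj HH_mal hH hH Hz _ z1).2.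
by rewrite conjgE zx mulKg.
Qed.

(** Adjacent generators commute, so malnormality carries membership of their conjugates in [H] along
    the edges of the connected graph. *)
Lemma malnormal_gen_commute H z s k : HH H -> H z -> z <> 1 ->
  z * gen s ^ k = gen s ^ k * z -> H = setT.
Proof.
move=> hH Hz z1 zs.
have genH t : H (gen t ^ k).
  have /connectP[p sp ->] := e_conn s t.
  have : H (gen s ^ k) by exact: malnormal_commute zs.
  elim: p s sp {zs} => //= u p IH s /andP[su up] Hs; apply: IH up _.
  apply: (malnormal_commute hH Hs); last by rewrite -!conjMg gen_comm.
  by apply/eqP; rewrite conjg_eq1 gen_neq1.
apply/seteqP; split=> // x _; rewrite -(conjgKV k x).
have [w ->] := ev_surj (x ^ k^-1); elim: w => [|t w IH].
  by rewrite conj1g; apply: subgroup1; exact: HH_sub.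
by rewrite conjMg; apply: subgroupM => //; exact: HH_sub.
Qed.

Lemma malnormal_free H z s k : HH H -> H <> setT -> H z ->
  (gen s ^ k) ^ z = gen s ^ k -> z = 1.
Proof.
move=> hH HT Hz zs; apply/eqP/negPn/negP => /eqP z1; apply: HT.
apply: (malnormal_gen_commute (s := s) (k := k) hH Hz z1).
by rewrite -{1}zs conjgE mulVKg.
Qed.

(** Write [z ^ g = a * b]. If [a] is trivial, [z] commutes with a conjugate of [gen s]. Otherwise
    the conjugate of [a] commutes with [z], so it lies in [H], and it commutes with a conjugate of
    [gen t]. *)
Lemma malnormal_join (L : pred V) H g z : HH H -> H <> setT ->
  (exists s, L s) -> (exists t, perp e L t) -> H z ->
  special [predU L & perp e L] (z ^ g) -> z = 1.
Proof.
move=> hH HT [s Ls] [t pt] Hz /(special_join e_sym)[a [b [La pb zE]]].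
have zE' : z = a ^ g^-1 * b ^ g^-1 by rewrite -conjMg -zE conjgK.
apply/eqP/negPn/negP => /eqP z1; apply: HT.
have [a1|/eqP a1] := eqVneq a 1.
  apply: (malnormal_gen_commute (s := s) (k := g^-1) hH Hz z1).
  rewrite zE' a1 conj1g mul1g -!conjMg.
  by rewrite (special_perp_commute e_sym (special_gen e Ls) pb).
have Ha : H (a ^ g^-1).
  apply: (malnormal_commute hH Hz z1).
  by rewrite zE' -!conjMg -mulgA (special_perp_commute e_sym La pb).
apply: (malnormal_gen_commute (s := t) (k := g^-1) hH Ha).
  by apply/eqP; rewrite conjg_eq1; apply/eqP.
by rewrite -!conjMg (special_perp_gen e_sym La pt).
Qed.

Definition bounded_proj H N := forall v g x y, H x -> H y ->
  (proj_dist g (star e v) x y <= N)%N.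

Lemma malnormal_bounded_proj H : HH H -> H <> setT -> exists N, bounded_proj H N.
Proof.
move=> hH HT; have [l lH H_words] := finitely_generated_words (HH_fg hH).
apply: (proj_dist_bound e_sym (HH_sub hH) _ _ lH H_words).
  by move=> z s k Hz; apply: malnormal_free hH HT Hz.
by move=> L g z Lne pne Hz; apply: malnormal_join hH HT Lne pne Hz.
Qed.

Lemma at_most_proj H N v g x y a : bounded_proj H N -> H (a^-1 * x) -> H (a^-1 * y) ->
  at_most (fun r => separates x y r /\ special (star e v) (r ^ g)) N.
Proof.
move=> HN Hx Hy; apply: (at_most_rel (f := fun r q => q = r ^ a))
  (proj_dist_at_most (HN v (a^-1 * g) _ _ Hx Hy)) => [r [xr sr]|r r' q _ _ ->].
  exists (r ^ a) => //; rewrite separates_mull conjgK; split=> //.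
  by rewrite conjgM conjgK.
exact: conjg_inj.
Qed.

Lemma word_wall H (l : seq G) x y r : is_subgroup H -> (forall a, a \in l -> H a) ->
  (forall h, H h -> exists2 w : seq G, {subset w <= l} & h = gprod w) ->
  H x -> H y -> separates x y r ->
  exists h a, [/\ H h, a \in l & separates h (h * a) r].
Proof.
move=> sH lH H_words Hx Hy.
have [|w wl wE] := H_words (x^-1 * y).
  by apply: subgroupM => //; apply: subgroupV.
rewrite -(mulVKg x y) wE => /separates_cross[w1 [a [w2 [wE' ar]]]].
exists (x * gprod w1), a; split=> //; last by apply: wl; rewrite wE' mem_cat mem_head orbT.
apply: subgroupM => //; apply: gprod_in => // b bw; apply/lH/wl.
by rewrite wE' mem_cat bw.
Qed.

(** Next to each common wall lie points [h] of [H] and [a * h'] of [a H']; if there are more than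
    [N] common walls, [h^-1 * (a * h')] stays in a fixed ball. Two distinct walls with the same data
    would give a nontrivial element of [H] in a conjugate of [H']. *)
Lemma common_walls_bound H H' : HH H -> HH H' -> H <> setT -> H' <> setT ->
  exists M, forall a x y x' y', H x -> H y -> H' (a^-1 * x') -> H' (a^-1 * y') ->
  ~ (H = H' /\ H a) ->
  at_most (fun r => separates x y r /\ separates x' y' r) M.
Proof.
move=> hH hH' HT HT'.
have [N HN] := malnormal_bounded_proj hH HT.
have [N' HN'] := malnormal_bounded_proj hH' HT'.
have [l lH H_words] := finitely_generated_words (HH_fg hH).
have [l' lH' H_words'] := finitely_generated_words (HH_fg hH').
have [K HK] := letter_bound l.
have [K' HK'] := letter_bound l'.
pose B := ball e (K + (K' + (N + (N + (N' + N'))))).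
pose rs := flatten [seq wall_seq 1 b | b <- l].
exists (N + size [seq (c, q) | c <- B, q <- rs])%N => a x y x' y' Hx Hy Hx' Hy' HHa.
move=> ws ws_uniq wsP.
have [wsN|Nws] := leqP (size ws) N; first by apply: leq_trans wsN (leq_addr _ _).
apply: leq_trans (leq_addl _ _).
suff : at_most (fun r => r \in ws) (size [seq (c, q) | c <- B, q <- rs]) by apply.
have sH := HH_sub hH; have sH' := HH_sub hH'.
apply: (at_most_rel (Q := fun cq => cq \in [seq (c, q) | c <- B, q <- rs])
  (f := fun r cq => exists h h', [/\ H h, H' h', cq.1 = h^-1 * (a * h') & r ^ h = cq.2])).
- move=> r rws; have [xr xr'] := wsP r rws.
  have [h [b [Hh bl hr]]] := word_wall sH lH H_words Hx Hy xr.
  have : separates (a^-1 * x') (a^-1 * y') (r ^ a) by rewrite separates_mull conjgK.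
  move=> /(word_wall sH' lH' H_words' Hx' Hy')[h' [b' [Hh' bl' hr']]].
  rewrite -separates_mull mulgA in hr'.
  exists (h^-1 * (a * h'), r ^ h); last by exists h, h'.
  apply/allpairsP; exists (h^-1 * (a * h'), r ^ h); split=> //; last first.
    apply/flattenP; exists (wall_seq 1 b); first exact: map_f.
    by move: hr; rewrite mem_wall_seq !separatesE mulKg invg1 mul1g conjg1.
  have [p [s [rE pP]]] := separates_edgeT hr.
  have [p' [s' [rE' pP']]] := separates_edgeT hr'.
  have [_ sp] : s = s' /\ special (star e s) (p^-1 * p').
    by apply: (same_wall e_sym); rewrite -rE.
  apply: mem_ball.
  (* The first two cases are walls crossed by one of the two letters; the other four commute with
     [r] and separate [h] or [a * h'] from an endpoint in its own coset. *)
  pose Q z := separates h (h * b) z \/ (separates (a * h') (a * h' * b') z \/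
    ((separates x h z /\ special (star e s) (z ^ p)) \/
    ((separates h y z /\ special (star e s) (z ^ p)) \/
    ((separates x' (a * h') z /\ special (star e s) (z ^ p)) \/
     (separates (a * h') y' z /\ special (star e s) (z ^ p)))))).
  have QB : at_most Q (K + (K' + (N + (N + (N' + N'))))).
    do 5?[apply: at_most_or]; try by [exact: HK | exact: HK'].
    + by apply: proj_dist_at_most; exact: HN.
    + by apply: proj_dist_at_most; exact: HN.
    + by apply: (at_most_proj (a := a) HN') => //; rewrite mulKg.
    + by apply: (at_most_proj (a := a) HN') => //; rewrite mulKg.
  apply: (at_most_rel (f := fun q z => z = q ^ h^-1)) QB =>
    [q cq|q q' z _ _ ->]; last exact: conjg_inj.
  exists (q ^ h^-1) => //.
  have hu : separates h (a * h') (q ^ h^-1) by rewrite separatesE conjgKV.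
  move: (q ^ h^-1) hu => {q cq} z hu.
  have [hbu|hbu] := boolP (separates h (h * b) z); first by left.
  have [hbu'|hbu'] := boolP (separates (a * h') (a * h' * b') z); first by right; left.
  have ppu : separates p p' z.
    move: (pP z) (pP' z) hu hbu hbu'; rewrite /separates.
    by do 6!case: sep => //=; intuition.
  have sup := separates_special sp ppu.
  have [xhu|xhu] := boolP (separates x h z); first by do 2!right; left.
  have [hyu|hyu] := boolP (separates h y z); first by do 3!right; left.
  have [xhu'|xhu'] := boolP (separates x' (a * h') z); first by do 4!right; left.
  have [hyu'|hyu'] := boolP (separates (a * h') y' z); first by do 5!right.
  have := hu; rewrite separatesE => /sep_refl[t [k ukE]].
  have uE : z = gen t ^ (k * h^-1) by rewrite conjgM -ukE conjgK.
  (* A wall [z] outside [Q] commutes with every common wall by [quadrants_commute], so these all lie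
     in one star coset, where the projection bound allows at most [N]. *)
  have ws_le : at_most (fun r => r \in ws) N.
    apply: at_most_sub (leqnn _) (proj_dist_at_most (HN t (k * h^-1)^-1 _ _ Hx Hy)).
    move=> q /wsP[xq xq']; split=> //.
    apply: (centralizer_gen e_sym (t := t) _).2.
    have qu : q * z = z * q.
      apply: (quadrants_commute e_sym xq xq' (q := z)).
      + by move: xhu hyu; rewrite /separates; do 3!case: sep.
      + by move: xhu' hyu'; rewrite /separates; do 3!case: sep.
      + by move: hu xhu hyu xhu' hyu'; rewrite /separates; do 6!case: sep.
    rewrite (_ : gen t = z ^ (k * h^-1)^-1); last by rewrite uE conjgK.
    by rewrite -!conjMg qu.
  by have := ws_le ws ws_uniq (fun _ => id); rewrite leqNgt Nws.
- move=> r r' [c q] /= _ _ [h [h' [Hh Hh' cE rE]]] [k [k' [Hk Hk' cE' rE']]].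
  have [hk|/eqP hk] := eqVneq (h * k^-1) 1.
    by apply: (@conjg_inj _ h); rewrite rE {1}(divg1_eq hk) rE'.
  case: HHa; apply: (malnormal_conj HH_mal hH hH' _ _ hk).
    by apply: subgroupM => //; apply: subgroupV.
  have E : a * h' = h * (k^-1 * (a * k')) by rewrite -cE' cE mulVKg.
  suff -> : (h * k^-1) ^ a = h' * k'^-1.
    by apply: subgroupM => //; apply: subgroupV.
  apply: (mulgI a); rewrite conjgE mulVKg mulgA E.
  by rewrite -!mulgA mulgV mulg1.
- by apply: (@at_most_seq _ [seq (c, q) | c <- B, q <- rs]).
Qed.

End Malnormal.

(** * Hyperbolically embedded collections *)

Section Bottleneck.
Variables (T : eqType) (E : rel T).
Implicit Types (x y z u v w : T) (p q r : seq T).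

Definition walk_le x y n := exists2 p, walk E x p y & (size p <= n)%N.

Lemma gdist_min x y n : gdist E x y = Some n ->
  (exists2 p, walk E x p y & size p = n) /\
  forall p, walk E x p y -> (n <= size p)%N.
Proof.
rewrite /gdist; case: pselect => // ex [<-]; case: ex_minnP => m /asboolP mP mmin.
by split=> // p xp; apply: mmin; apply/asboolP; exists p.
Qed.

Lemma walk_le_gdist_le x y n : walk_le x y n -> gdist_le E x y n.
Proof.
move=> [p xp pn]; rewrite /gdist_le.
case E1 : (gdist E x y) => [m|]; first exact: leq_trans ((gdist_min E1).2 p xp) pn.
move: E1; rewrite /gdist; case: pselect => // -[].
by exists (size p); apply/asboolP; exists p.
Qed.

Lemma walk_cat x p y q z : walk E x p y -> walk E y q z -> walk E x (p ++ q) z.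
Proof. by move=> [xp <-] [yq <-]; rewrite /walk cat_path last_cat xp. Qed.

Lemma walk_le0 x n : walk_le x x n. Proof. by exists [::]. Qed.

Lemma walk_le1 x y : E x y -> walk_le x y 1.
Proof. by move=> xy; exists [:: y]; rewrite // /walk /= xy. Qed.

Lemma walk_le_trans x y z m n : walk_le x y m -> walk_le y z n -> walk_le x z (m + n).
Proof.
move=> [p xp pm] [q yq qn]; exists (p ++ q); first exact: walk_cat yq.
by rewrite size_cat leq_add.
Qed.

Lemma walk_le_leq x y m n : (m <= n)%N -> walk_le x y m -> walk_le x y n.
Proof. by move=> mn [p xp pm]; exists p => //; apply: leq_trans mn. Qed.

Hypothesis E_sym : symmetric E.

Lemma walk_rev x p y : walk E x p y -> exists q,
  [/\ walk E y q x, y :: q =i x :: p & size q = size p].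
Proof.
move=> [xp <-]; exists (rev (belast x p)).
have lastE : last x p :: rev (belast x p) = rev (x :: p) by rewrite [in RHS]lastI rev_rcons.
split; last by rewrite size_rev size_belast.
  split.
    by rewrite rev_path (eq_path (e' := E)) // => a b; exact: E_sym.
  by case: p {xp lastE} => //= z p; rewrite rev_cons last_rcons.
by move=> z; rewrite lastE mem_rev.
Qed.

Lemma walk_le_sym x y n : walk_le x y n -> walk_le y x n.
Proof. by move=> [p /walk_rev[q [yq _ sz]] pn]; exists q; rewrite ?sz. Qed.

Lemma path_transition (P Q : T -> Prop) x p : path E x p ->
  (forall z, z \in x :: p -> P z \/ Q z) -> P x -> Q (last x p) ->
  exists w w', [/\ w \in x :: p, P w, Q w' & walk_le w w' 1].
Proof.
elim: p x => [|y p IH] x /=.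
  by move=> _ _ Px Qx; exists x, x; rewrite mem_head; split=> //; exact: walk_le0.
case/andP=> xy yp PQ Px Qp.
have [|Py|Qy] := PQ y; first by rewrite in_cons mem_head orbT.
  have [|w [w' [wp Pw Qw ww']]] := IH y yp _ Py Qp.
    by move=> z zp; apply: PQ; rewrite in_cons zp orbT.
  by exists w, w'; split=> //; rewrite in_cons wp orbT.
by exists x, y; rewrite mem_head; split=> //; exact: walk_le1.
Qed.

(** Some step of the chosen path leads from a vertex [w] near the part of [p] before [u] to one near
    the part after [u]. As [p] is geodesic, [u] is near [w], and [w] is near the walk formed by the
    two other sides. *)
Lemma bottleneck_hyperbolic d :
  (forall x y, exists2 p, walk E x p y & forall w, w \in x :: p ->
     forall q, walk E x q y -> exists2 v, v \in x :: q & walk_le w v d) ->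
  hyperbolic E.
Proof.
(* [u] is within [2 * d + 1] of [v1], hence within [3 * d + 1] of [w], which is within [d] of the
   other sides. *)
move=> bneck; exists (4 * d + 1)%N => x y z p q r [xp pgeo] [yq _] [zr _] u up.
have [h xh hP] := bneck x y.
have [p1 [p2 [pE uE]]] : exists p1 p2, p = p1 ++ p2 /\ u = last x p1.
  by case/splitPl: up => p1 p2 pu; exists p1, p2.
have xp1 : walk E x p1 u by move: xp => [+ _]; rewrite pE cat_path => /andP[].
have up2 : walk E u p2 y.
  by move: xp => []; rewrite pE cat_path last_cat -uE => /andP[].
pose P w := exists2 v, v \in x :: p1 & walk_le w v d.
pose Q w := exists2 v, v \in u :: p2 & walk_le w v d.
have [||||w [w' [wh [v1 v1p w1] [v2 v2p w2] ww']]] := @path_transition P Q x h.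
- by case: xh.
- move=> w /hP /(_ p xp)[v]; rewrite pE -cat_cons mem_cat => /orP[vp|vp] wv.
    by left; exists v.
  by right; exists v => //; rewrite in_cons vp orbT.
- by exists x; rewrite ?mem_head //; exact: walk_le0.
- by rewrite xh.2; exists y; [rewrite -(up2.2) mem_last | exact: walk_le0].
have [a1 [a2 [p1E v1E]]] : exists a1 a2, p1 = a1 ++ a2 /\ v1 = last x a1.
  by case/splitPl: v1p => a1 a2 av; exists a1, a2.
have [b1 [b2 [p2E v2E]]] : exists b1 b2, p2 = b1 ++ b2 /\ v2 = last u b1.
  by case/splitPl: v2p => b1 b2 bv; exists b1, b2.
have xa1 : walk E x a1 v1 by move: xp1 => [+ _]; rewrite p1E cat_path => /andP[].
have v1a2 : walk E v1 a2 u.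
  by move: xp1 => []; rewrite p1E cat_path last_cat -v1E => /andP[].
have v2b2 : walk E v2 b2 y.
  by move: up2 => []; rewrite p2E cat_path last_cat -v2E => /andP[].
have [m v12 mn] : walk_le v1 v2 (d + (1 + d)).
  by apply: walk_le_trans (walk_le_sym w1) (walk_le_trans ww' w2).
have := (gdist_min pgeo).2 _ (walk_cat (walk_cat xa1 v12) v2b2).
rewrite pE p1E p2E !size_cat => sz.
have uw : walk_le u w (2 * d + 1 + d).
  apply: walk_le_trans (walk_le_sym w1); apply: walk_le_sym; exists a2 => //.
  by move: sz mn; move: (size a1) (size a2) (size b1) (size b2) (size m) => *; lia.
have [r' [xr' r'E _]] := walk_rev zr.
have [q' [zq' q'E _]] := walk_rev yq.
have [v vp wv] := hP w wh _ (walk_cat xr' zq').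
exists v; last first.
  by apply: walk_le_gdist_le; apply: walk_le_leq (walk_le_trans uw wv); lia.
move: vp; rewrite -cat_cons mem_cat r'E orbC => /orP[vq|->]; last by rewrite orbT.
by rewrite -q'E in_cons vq orbT.
Qed.

End Bottleneck.

Lemma cay_sym (G : groupType) (X : set G) HH : symmetric (cay X HH).
Proof. by move=> x y; apply: asbool_equiv_eq; split=> -[a [xa|ya]]; exists a; tauto. Qed.

(** * Malnormal collections of proper subgroups are hyperbolically embedded *)

Section ForwardDirection.
Variables (V : finType) (e : rel V).
Hypothesis e_sym : symmetric e.
Hypothesis e_conn : forall s t, connect e s t.
Local Notation G := (racg e).
Local Notation gen := (gen e).
Local Notation ev := (ev e).
Implicit Types (H : set G) (s t : V) (a b g h k x y z r : G) (w : seq V).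

Variable HH : set (set G).
Hypothesis HH_fin : finite_set HH.
Hypothesis HH_sub : forall H, HH H -> is_subgroup H.
Hypothesis HH_fg : forall H, HH H -> finitely_generated H.

(** With the star subgroups as letters, the points next to a given wall are one step apart, by
    [same_wall]. *)
Definition star_union : set G := [set k | exists v, special (star e v) k].

Local Notation Cay := (cay star_union HH).

Lemma walk_le_star v x y : special (star e v) (x^-1 * y) -> walk_le Cay x y 1.
Proof.
move=> xy; apply/walk_le1/asboolP; exists (Base (x^-1 * y)); left.
by split; [exists v | rewrite /= mulVKg].
Qed.

Lemma walk_le_coset H h x : HH H -> H h -> walk_le Cay x (x * h) 1.
Proof. by move=> hH Hh; apply/walk_le1/asboolP; exists (Periph H h); left. Qed.

Fixpoint word_path x w : seq G :=
  if w is s :: w' then x * gen s :: word_path (x * gen s) w' else [::].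

Lemma word_path_walk x w : walk Cay x (word_path x w) (x * ev w).
Proof.
elim: w x => [|s w IH] x /=; first by rewrite mulg1.
have [xp xl] := IH (x * gen s); split; rewrite /= ?xp ?xl ?mulgA // andbT.
apply/asboolP; exists (Base (gen s)); left; split=> //.
by exists s; apply: special_gen; rewrite /star /= eqxx.
Qed.

Lemma size_word_path x w : size (word_path x w) = size w.
Proof. by elim: w x => //= s w IH x; rewrite IH. Qed.

Lemma walk_le_walls x y n : at_most (fun r => separates x y r) n -> walk_le Cay x y n.
Proof.
have [w rw xy] := reduced_ev (x^-1 * y).
have -> : y = x * ev w by rewrite -xy mulVKg.
move=> xyn; exists (word_path x w); first exact: word_path_walk.
rewrite size_word_path -(size_walls e) -(size_map (fun r => r ^ x^-1)).
apply: xyn => [|r /mapP[q qw ->]]; first by rewrite map_inj_uniq //; exact: conjg_inj.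
by rewrite separatesE mulKg conjgKV sep_reduced.
Qed.

Lemma word_path_split x w z : z \in x :: word_path x w ->
  exists w1 w2, w = w1 ++ w2 /\ z = x * ev w1.
Proof.
elim: w x => [|s w IH] x /=.
  by rewrite inE => /eqP->; exists [::], [::]; rewrite mulg1.
rewrite in_cons => /orP[/eqP->|/IH[w1 [w2 [-> ->]]]].
  by exists [::], (s :: w); rewrite mulg1.
by exists (s :: w1), w2; rewrite /= mulgA.
Qed.

Lemma walk_crosses (E : rel G) x p y r : walk E x p y -> separates x y r ->
  exists g g', [/\ g \in x :: p, g' \in x :: p, E g g' & separates g g' r].
Proof.
move=> [+ <-]; elim: p x => [|z p IH] x /=; first by rewrite /separates addbb.
case/andP=> xz zp /(@separates_trans _ _ z) /orP[xzr|].
  by exists x, z; rewrite !in_cons !eqxx ?orbT.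
move=> /(IH _ zp)[g [g' [gp gp' gg' gr]]]; exists g, g'.
by rewrite !(in_cons x) gp gp' !orbT.
Qed.

Lemma walk_le_wall_star v g0 a z s : special (star e v) a ->
  separates g0 (g0 * a) (gen s ^ z^-1) -> walk_le Cay z g0 2.
Proof.
move=> va; move: va (va); rewrite -{1}(mulKg g0 a) => /separates_edge sE va.
move=> /sE[p [t [_ vp rE _]]].
have [_ sp] : s = t /\ special (star e s) (z^-1 * p).
  by apply: (same_wall e_sym).
apply: (@walk_le_trans _ _ _ p _ 1 1); first exact: walk_le_star sp.
by apply: (walk_le_sym (@cay_sym _ _ _)); exact: walk_le_star vp.
Qed.

Lemma walk_le_wall_coset H : HH H -> exists n, forall g0 a z s, H a ->
  separates g0 (g0 * a) (gen s ^ z^-1) -> walk_le Cay z g0 n.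
Proof.
move=> hH; have [l lH H_words] := finitely_generated_words (HH_fg hH).
have sH := HH_sub hH; have [K HK] := letter_bound l.
(* One star letter from [z] to [p], at most [K] generators back along the path of the letter [b],
   and one letter of [H] back to [g0]. *)
exists (1 + (K + 1))%N => g0 a z s Ha.
have [w wl ->] := H_words a Ha; move=> /separates_cross[w1 [b [w2 [wE br]]]].
have [p [t [rE pP]]] := separates_edgeT br.
have [_ sp] : s = t /\ special (star e s) (z^-1 * p).
  by apply: (same_wall e_sym).
apply: walk_le_trans (walk_le_star sp) _; apply: (walk_le_sym (@cay_sym _ _ _)).
rewrite addnC; apply: walk_le_trans (walk_le_coset g0 hH (h := gprod w1) _) _.
  by apply: gprod_in => // c cw; apply/lH/wl; rewrite wE mem_cat cw.
apply: walk_le_walls; apply: at_most_sub (leqnn _) (HK b (g0 * gprod w1) _) => //.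
by apply: wl; rewrite wE mem_cat mem_head orbT.
Qed.

(** Word geodesics are bottlenecks: the wall just after a vertex [z] separates the endpoints, so
    every walk between them crosses it, at an edge close to [z]. *)
Lemma cay_hyperbolic : hyperbolic Cay.
Proof.
have [n nP] : exists n, forall H, HH H -> forall g0 a z s, H a ->
    separates g0 (g0 * a) (gen s ^ z^-1) -> walk_le Cay z g0 n.
  apply: finite_max HH_fin _ walk_le_wall_coset => H m k mk Pm g0 a z s Ha zs.
  exact: walk_le_leq mk (Pm _ _ _ _ Ha zs).
apply: (@bottleneck_hyperbolic _ _ (@cay_sym _ _ _) (n + 2)) => x y.
have [w rw xy] := reduced_ev (x^-1 * y).
have yE : y = x * ev w by rewrite -xy mulVKg.
exists (word_path x w); first by rewrite yE; exact: word_path_walk.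
(* No wall follows the last vertex, but that vertex is [y], which lies on every walk. *)
move=> z /word_path_split[w1 [[|s w2] [wE zE]]] q xq.
  exists y; last by rewrite zE yE wE cats0; exact: walk_le0.
  by rewrite -(xq.2) mem_last.
have xyr : separates x y (gen s ^ z^-1).
  rewrite separatesE xy zE invgM conjgM conjgKV sep_reduced // wE walls_cat mem_cat.
  by rewrite walls_cons map_cons mem_head orbT.
have [g [g' [gq gq' /asboolP[a gg'] gr]]] := walk_crosses xq xyr.
have [g0 [g0q ga g0r]] : exists g0, [/\ g0 \in x :: q, alphabet star_union HH a &
    separates g0 (g0 * letter_val a) (gen s ^ z^-1)].
  case: gg' => -[ga gE]; [exists g | exists g']; split=> //; rewrite -gE //.
  by rewrite separatesC.
exists g0 => //; case: a ga g0r {gg'} => [a [v va]|H a [hH Ha]] /= g0r.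
  by apply: walk_le_leq (walk_le_wall_star va g0r); rewrite leq_addl.
by apply: walk_le_leq (nP _ hH _ _ _ _ Ha g0r); rewrite leq_addr.
Qed.

Lemma star_union_generates : generated (star_union `|` \bigcup_(H in HH) H) = setT.
Proof.
apply/seteqP; split=> // x _ K [sK XK].
have [w ->] := ev_surj x; elim: w => [|s w IH]; first exact: subgroup1.
apply: subgroupM => //; apply: XK; left; exists s.
by apply: special_gen; rewrite /star /= eqxx.
Qed.

Hypothesis HH_mal : malnormal HH.
Hypothesis HH_proper : forall H, HH H -> H <> setT.

(** Letters of [star_union] fall under the projection bound, the others under [common_walls_bound];
    its excluded case is that of the inner edges. *)
Lemma outer_edge_walls H : HH H -> exists M, forall h k g (a : letter G) g', H h -> H k ->
  outer_edge star_union HH H g a g' ->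
  at_most (fun r => separates h k r /\ separates g g' r) M.
Proof.
move=> hH; have HT := HH_proper hH.
have [N HN] := malnormal_bounded_proj e_sym e_conn HH_sub HH_fg HH_mal hH HT.
have [M MP] : exists M, forall H', HH H' -> forall a x y x' y', H x -> H y ->
    H' (a^-1 * x') -> H' (a^-1 * y') -> ~ (H = H' /\ H a) ->
    at_most (fun r => separates x y r /\ separates x' y' r) M.
  apply: finite_max HH_fin _ _.
    move=> H' m n mn Pm a x y x' y' Hx Hy Hx' Hy' Ha.
    exact: at_most_sub mn (Pm a x y x' y' Hx Hy Hx' Hy' Ha).
  move=> H' hH'.
  exact: (common_walls_bound e_sym e_conn HH_sub HH_fg HH_mal hH hH' HT (HH_proper hH')).
exists (N + M)%N => h k g [b|H' b] g' Hh Hk [[/= ab ->] inner].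
  case: ab => v vb.
  apply: at_most_sub (leq_addr _ _) (proj_dist_at_most (HN v g h k Hh Hk)) => r [hr gr].
  by split=> //; apply: separates_special gr; rewrite mulKg.
case: ab => hH' Hb.
apply: at_most_sub (leq_addl _ _) (MP H' hH' g h k g (g * b) Hh Hk _ _ _) => //.
- by rewrite mulVg; apply: subgroup1; exact: HH_sub.
- by rewrite mulKg.
- move=> [HE Hg]; case: inner; split=> //; last by exists b; rewrite HE.
  by apply: subgroupM => //; [exact: HH_sub | rewrite HE].
Qed.

(** Each edge of an outer path from [h] to [k] crosses at most [M] of the walls between them, so
    [h^-1 * k] lies in the ball of radius [n * M]. *)
Lemma star_union_locally_finite H : HH H -> dhat_locally_finite star_union HH H.
Proof.
move=> hH h n Hh; have [M MP] := outer_edge_walls hH.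
have pathP k x p : H k -> path (outer_cay star_union HH H) x p ->
    at_most (fun r => separates h k r /\ separates x (last x p) r) (size p * M).
  move=> Hk; elim: p x => [|y p IH] x /=.
    by move=> _ [|r rs] // _ /(_ r (mem_head _ _))[_]; rewrite /separates addbb.
  case/andP=> /asboolP[a xy] yp; rewrite mulSn.
  apply: at_most_sub (leqnn _) (at_most_or (P := fun r => separates h k r /\ separates x y r)
    _ (IH y yp)).
    by move=> r [hr /(@separates_trans _ _ y)/orP[]]; [left | right].
  case: xy => xy; first exact: MP xy.
  by apply: at_most_sub (leqnn _) (MP _ _ _ _ _ Hh Hk xy) => r; rewrite (separatesC x).
apply: (@sub_finite_set _ _ [set` [seq h * c | c <- ball e (n * M)]]); last exact: finite_seq.
move=> k [Hk [m dm mn]] /=; have [[p [hp pk] pm] _] := gdist_min dm.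
rewrite -pm in mn.
apply/mapP; exists (h^-1 * k); last by rewrite mulVKg.
apply: mem_ball; apply: at_most_sub (leq_mul mn (leqnn M)) _ => [r hr|]; first exact: hr.
apply: (at_most_rel (f := fun r q => q = r ^ h^-1)) (pathP k h p Hk hp) =>
  [r hr|r r' q _ _ ->]; last exact: conjg_inj.
by exists (r ^ h^-1) => //; rewrite pk separatesE conjgKV.
Qed.

Lemma proper_hyp_embedded : hyp_embedded HH.
Proof.
exists star_union; split; first exact: star_union_generates.
  exact: cay_hyperbolic.
exact: star_union_locally_finite.
Qed.

End ForwardDirection.

(** * The improper case and the converse *)

Section HyperbolicallyEmbedded.
Variables (G : groupType) (HH : set (set G)).
Implicit Types (X H : set G) (g h x y z : G).
Hypothesis HH_sub : forall H, HH H -> is_subgroup H.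

(** The members other than [setT] are trivial. Without base letters, the letters of [setT] join any
    two points, while the edges outer to [setT] are loops. *)
Lemma improper_hyp_embedded : malnormal HH -> HH setT -> hyp_embedded HH.
Proof.
move=> mal HT; have triv H b : HH H -> H <> setT -> H b -> b = 1.
  move=> hH nT Hb; apply: contrapT => b1; apply: nT.
  by apply: (malnormal_conj mal hH HT (x := 1) Hb _ b1).1.
exists set0; split.
- by apply/seteqP; split=> // x _ K [_ XK]; apply: XK; right; exists setT.
- exists 1%N => x y z p q r _ _ _ u _; exists y; first by rewrite mem_head.
  apply/walk_le_gdist_le/walk_le1/asboolP; exists (Periph setT (u^-1 * y)); left.
  by split=> //=; rewrite mulVKg.
move=> H hH h n Hh; have [HE|HE] := pselect (H = setT); last first.
  apply: (@sub_finite_set _ _ [set 1]); last exact: finite_set1.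
  by move=> k [Hk _]; apply: triv Hk.
apply: (@sub_finite_set _ _ [set h]); last exact: finite_set1.
move=> k [_ [m dm _]]; have [[p [hp <-] _] _] := gdist_min dm.
elim: p h hp {Hh dm} => //= y p IH h /andP[/asboolP[a hy] /IH ->].
suff E g g' : outer_edge set0 HH H g a g' -> g' = g by case: hy => /E.
case: a {hy} => [b [[]//]|H' b [[/= [hH' Hb] ->]] inner].
have [H'E|H'E] := pselect (H' = setT); last by rewrite (triv H' b) ?mulg1.
by case: inner; split; rewrite ?HE //; exists b; rewrite H'E.
Qed.

Lemma cay_mull X h g g' : cay X HH (h * g) (h * g') = cay X HH g g'.
Proof.
have E a u v : cay_edge X HH (h * u) a (h * v) <-> cay_edge X HH u a v.
  rewrite /cay_edge -mulgA; split=> -[aX /= vE]; split=> //; last by rewrite vE.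
  exact: mulgI vE.
by apply: asbool_equiv_eq; split=> -[a ga]; exists a; move: ga; rewrite !E.
Qed.

Lemma walk_mull X h x p y : walk (cay X HH) x p y ->
  walk (cay X HH) (h * x) [seq h * z | z <- p] (h * y).
Proof.
move=> [xp <-]; split; last exact: last_map.
by rewrite (mono_path (cay_mull X h)).
Qed.

Lemma cay_connected X x y : generated (X `|` \bigcup_(H in HH) H) = setT ->
  exists p, walk (cay X HH) x p y.
Proof.
move=> gen; rewrite -(mulVKg x y); move: (x^-1 * y) => {}y.
have : [set: G] y by [].
rewrite -gen => /(_ [set g | forall x, exists p, walk (cay X HH) x p (x * g)]); apply.
split; first split=> [z|g g' gP g'P z].
- by exists [::]; rewrite mulg1.
- have [p zp] := gP z; have [q] := g'P (z * (g * g'^-1)).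
  rewrite mulgA mulgVK => /(walk_rev (@cay_sym _ X HH))[q' [zq' _ _]].
  exists (p ++ q'); exact: walk_cat zq'.
- move=> g Xg z; exists [:: z * g]; rewrite /walk /= andbT; split=> //.
  apply/asboolP; case: Xg => [Xg|[H hH Hg]]; first by exists (Base g); left.
  by exists (Periph H g); left.
Qed.

Lemma outer_cay_sym X H : symmetric (outer_cay X HH H).
Proof. by move=> x y; apply: asbool_equiv_eq; split=> -[a [xa|ya]]; exists a; tauto. Qed.

(** An inner edge has both ends in [H], so it suffices to avoid [H] after the start. *)
Lemma path_outer X H x p : path (cay X HH) x p -> (forall y, y \in p -> ~ H y) ->
  path (outer_cay X HH H) x p.
Proof.
elim: p x => //= y p IH x /andP[/asboolP[a xy] yp] pH; rewrite IH //; last first.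
  by move=> z zp; apply: pH; rewrite in_cons zp orbT.
rewrite andbT; apply/asboolP; exists a.
have Hy : ~ H y by apply: pH; rewrite mem_head.
by case: xy => xy; [left | right]; split=> // -[].
Qed.

(* A path of minimal length from [1] to the double coset [H g H'] meets [H] only
   at [1]. *)
Lemma double_coset_path X H H' g : HH H ->
  generated (X `|` \bigcup_(H in HH) H) = setT -> is_subgroup H' ->
  exists a b p, [/\ H a, H' b, walk (cay X HH) 1 p (a * g * b) &
    forall y, y \in p -> ~ H y].
Proof.
move=> hH gen sH'; have sH := HH_sub hH.
pose P n := `[< exists a b p,
  [/\ H a, H' b, walk (cay X HH) 1 p (a * g * b) & size p = n] >].
have exP : exists n, P n.
  have [p pg] := cay_connected 1 g gen; exists (size p); apply/asboolP.
  by exists 1, 1, p; rewrite mul1g mulg1; split=> //; exact: subgroup1.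
case: (ex_minnP exP) => n /asboolP[a [b [p [Ha Hb pg pn]]]] nmin.
exists a, b, p; split=> // y yp Hy.
case/splitPr: yp pg pn => p1 p2 [+ pl] pn.
rewrite cat_path /= => /and3P[_ _ yp2].
(* If [p] returned to [H] at [y], its remaining part translated by [y^-1] would be a shorter
   path. *)
have : P (size p2).
  apply/asboolP; exists (y^-1 * a), b, [seq y^-1 * z | z <- p2]; split=> //.
  - by apply: subgroupM => //; apply: subgroupV.
  - have := walk_mull y^-1 (conj yp2 erefl : walk (cay X HH) y p2 _).
    by rewrite last_cat /= in pl; rewrite mulVg pl !mulgA.
  - by rewrite size_map.
by move/nmin; rewrite -pn size_cat /=; lia.
Qed.

Lemma hyp_embedded_malnormal :
  (forall H, HH H -> torsion_free H) -> hyp_embedded HH -> malnormal HH.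
Proof.
move=> tf [X [gen _ lf]] H H' g hH hH' HE.
have sH := HH_sub hH; have sH' := HH_sub hH'.
have [z [Hz [h H'h zE] z1]] : exists z,
    [/\ H z, [set g * h * g^-1 | h in H'] z & z <> 1].
  apply: contrapT => nz; apply: HE; apply/seteqP; split.
    by move=> z [Hz zg]; apply: contrapT => z1; apply: nz; exists z.
  move=> _ ->; split; first exact: subgroup1.
  by exists 1; rewrite ?mulg1 ?mulgV //; exact: subgroup1.
apply: contrapT => nHg.
have [a [b [p [Ha H'b [pp pl] pH]]]] := double_coset_path g hH gen sH'.
(* [f] and [c] are conjugates of [z] and [h] chosen so that [f * k = k * c]. *)
pose c := b^-1 * h * b; pose f := a * z * a^-1; pose k := a * g * b.
have H'c : H' c by apply: subgroupM => //; apply: subgroupM => //; apply: subgroupV.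
have Hf : H f by apply: subgroupM => //; [apply: subgroupM | apply: subgroupV].
have f1 : f <> 1.
  move=> f1; apply: z1; apply: (mulgI a); apply: (mulIg a^-1).
  by rewrite mulg1 mulgV; exact: f1.
have fk : f * k = k * c.
  by rewrite /f /k /c -zE -!mulgA !mulKg !mulVKg.
have powX (K : set G) x n : is_subgroup K -> K x -> K (x ^+ n).
  move=> sK Kx; elim: n => [|n IH]; first exact: subgroup1.
  by rewrite expgS; exact: subgroupM.
have fkn n : f ^+ n * k = k * c ^+ n.
  elim: n => [|n IH]; first by rewrite !expg0 mul1g mulg1.
  by rewrite expgS -mulgA IH mulgA fk -mulgA -expgS.
(* This edge is labelled by a letter of [H']; it is inner only if [H = H'] and [k] is in [H], which
   would put [g] in [H]. *)
have kout n : outer_cay X HH H k (k * c ^+ n).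
  apply/asboolP; exists (Periph H' (c ^+ n)); left; split.
    by split=> //=; split=> //; exact: powX.
  move=> [Hk _ [h' [H'E _]]]; apply: nHg; split=> //; rewrite H'E in H'b.
  have -> : g = a^-1 * k * b^-1 by rewrite /k -!mulgA mulKg mulgV mulg1.
  by apply: subgroupM (subgroupV sH H'b) => //; apply: subgroupM => //; apply: subgroupV.
have out1 : walk (outer_cay X HH H) 1 p k by split; [exact: path_outer|].
have outf n : walk (outer_cay X HH H) (f ^+ n) [seq f ^+ n * x | x <- p] (f ^+ n * k).
  have [fp fl] := walk_mull (f ^+ n) (conj pp pl : walk (cay X HH) 1 p k).
  rewrite mulg1 in fp fl; split=> //; apply: path_outer => //.
  move=> _ /mapP[x xp ->] Hx; apply: (pH x xp).
  by rewrite -(mulKg (f ^+ n) x); exact: subgroupM sH (subgroupV sH (powX _ _ _ sH Hf)) Hx.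
(* Along [p] to [k], one edge to [k * c ^+ n = f ^+ n * k], then back along the translate of [p] to
   [f ^+ n]. *)
have inball n : dhat_ball X HH H 1 (size p + (1 + size p)) (f ^+ n).
  split; first exact: powX.
  have : walk_le (outer_cay X HH H) 1 (f ^+ n) (size p + (1 + size p)).
    apply: walk_le_trans (ex_intro2 _ _ p out1 (leqnn _)) _.
    apply: walk_le_trans (walk_le1 (kout n)) _; rewrite -fkn.
    have [q [kq _ sq]] := walk_rev (@outer_cay_sym X H) (outf n).
    by exists q; rewrite // sq size_map.
  move=> /walk_le_gdist_le; rewrite /gdist_le /dhat; case: gdist => // m; by exists m.
have /finite_seqP[s sE] := lf H hH 1 (size p + (1 + size p))%N (subgroup1 sH).
(* By torsion-freeness the powers of [f] are distinct, so one more of them than the length of [s]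
   cannot fit in the ball. *)
have : (size [seq f ^+ n | n <- iota 0 (size s).+1] <= size s)%N.
  apply: uniq_leq_size; last first.
    by move=> _ /mapP[n _ ->]; have : [set` s] (f ^+ n) by rewrite -sE; exact: inball.
  rewrite map_inj_uniq ?iota_uniq // => i j.
  wlog ij : i j / (i <= j)%N.
    by move=> W fij; case: (leqP i j) => [/W->//|/ltnW/W ->].
  move=> fij; apply/eqP; rewrite eqn_leq ij leqNgt; apply/negP => ltij.
  apply: f1; apply: (tf H hH f (j - i)%N) => //; first by rewrite subn_gt0.
  by apply: (mulgI (f ^+ i)); rewrite -expgnDr subnKC // fij mulg1.
by rewrite size_map size_iota ltnn.
Qed.

End HyperbolicallyEmbedded.

Theorem corollary1p8 (V : finType) (e : rel V)
    (e_sym : symmetric e) (e_irr : irreflexive e)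
    (e_conn : forall x y : V, connect e x y)
    (HH : set (set (racg e))) (HH_fin : finite_set HH)
    (HH_sub : forall H : set (racg e), HH H -> is_subgroup H)
    (HH_fg : forall H : set (racg e), HH H -> finitely_generated H) :
  (malnormal HH -> hyp_embedded HH) /\
  ((forall H : set (racg e), HH H -> torsion_free H) ->
   hyp_embedded HH -> malnormal HH).
Proof.
split=> [mal|]; last exact: hyp_embedded_malnormal.
have [HT|nHT] := pselect (HH setT); first exact: improper_hyp_embedded.
apply: proper_hyp_embedded => //.
by move=> H hH HE; apply: nHT; rewrite -HE.
Qed.
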